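(* Let $t\ge 2$ and let $n,l,u\ge 1$ be integers. Let $\mathcal{C}_0$ be a $t$-erasure-correcting quantum code of $n$ $l$-adic qudits encoding $u$ $l$-adic qudits, let $\mathcal{C}_{n,l,t}$ be the Matsumoto–Hagiwara code obtained from $\mathcal{C}_0$, let $|\mu\rangle\in P(\mathcal{H}_l^{\otimes u})$ be any message, and let $|\psi\rangle\in\mathcal{C}_{n,l,t}$ be the corresponding codeword. Then for every received state $\rho\in\mathscr{L}^{(1)}(|\psi\rangle)$ (i.e. every state obtained from $|\psi\rangle$ by a single insertion followed by a single deletion), the output $\hat\pi$ of the decoding algorithm described in the context on input $\rho$ satisfies $\hat\pi=|\mu\rangle$ (that is, $\hat\pi=|\mu\rangle\langle\mu|$ as a density matrix, for every sequence of measurement results occurring with nonzero probability).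
   Context: Notation. $[b]=\{1,\dots,b\}$, $\mathbb{Z}_q=\{0,\dots,q-1\}$. $\mathcal{H}_d=\mathbb{C}^d$ with orthonormal basis $|0\rangle,\dots,|d-1\rangle$; $S(\mathcal{H}_d^{\otimes n})$ is the set of density matrices on $\mathcal{H}_d^{\otimes n}$ and $P(\mathcal{H}_d^{\otimes n})$ the subset of pure states; a unit vector $|\mu\rangle$ also denotes the pure state $|\mu\rangle\langle\mu|$. Deletion and insertion of qudits. For $J\subseteq[n]$ and $\rho\in S(\mathcal{H}_d^{\otimes n})$, $\mathcal{D}_J(\rho)$ is the partial trace of $\rho$ over the qudits at positions in $J$ (the remaining qudits keep their order); this is the result of $|J|$ deletions. For $j\in[n+1]$ and $\pi\in S(\mathcal{H}_d)$, $\mathcal{I}_{\{j\},\pi}(\rho)\in S(\mathcal{H}_d^{\otimes(n+1)})$ is the state $\pi\otimes\rho$ with the qudits reordered so that the qudit carrying $\pi$ is at position $j$ and the $n$ qudits carrying $\rho$ occupy the other positions in their original order. For pure $\rho\in P(\mathcal{H}_d^{\otimes n})$, $\mathscr{L}^{(1)}(\rho)=\{\mathcal{D}_{\{j_1\}}\circ\mathcal{I}_{\{j_2\},\pi}(\rho)\mid j_1,j_2\in[n+1],\ \pi\in S(\mathcal{H}_d)\}$. Codes. A $t$-erasure-correcting quantum code $\mathcal{C}_0\subseteq P(\mathcal{H}_l^{\otimes n})$ with messages in $P(\mathcal{H}_l^{\otimes u})$ is given by a linear isometric encoder $\mathcal{H}_l^{\otimes u}\to\mathcal{H}_l^{\otimes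 n}$ such that for every $J\subseteq[n]$ with $|J|\le t$ there is a quantum operation (depending on $J$) recovering every message from $\mathcal{D}_J$ of its codeword. For $i\in\{0,\dots,t\}$ let $\eta_i:\mathcal{H}_l\to\mathcal{H}_{l(t+1)}$ be the isometry $|j\rangle\mapsto|j(t+1)+i\rangle$. The code $\mathcal{C}_{n,l,t}\subseteq P(\mathcal{H}_{l(t+1)}^{\otimes n})$ consists of the states obtained from codewords of $\mathcal{C}_0$ by applying $\eta_{(i-1)\bmod(t+1)}$ to the $i$th qudit for every $i\in[n]$; the codeword of a message $|\mu\rangle$ is obtained by encoding $|\mu\rangle$ in $\mathcal{C}_0$ and then applying these maps. Let $\boldsymbol{m}=(m_1,\dots,m_n)$ with $m_i=(i-1)\bmod(t+1)$. Measurement. $\mathcal{M}_t$ is the projective measurement $\{\mathbf{M}_k\mid k\in\{0,\dots,t\}\}$ on $\mathcal{H}_{l(t+1)}$ with $\mathbf{M}_k=\sum_{j=0}^{l-1}|j(t+1)+k\rangle\langle j(t+1)+k|$. Measuring every qudit of an $n$-qudit state $\rho$ gives the result sequence $\boldsymbol{r}\in\mathbb{Z}_{t+1}^n$ with probability $\mathrm{tr}(\mathbf{M}_{\boldsymbol r}\rho)$ and post-measurement state $\mathbf{M}_{\boldsymbol r}\rho\mathbf{M}_{\boldsymbol r}^\dagger/\mathrm{tr}(\mathbf{M}_{\boldsymbol r}\rho)$, where $\mathbf{M}_{\boldsymbol r}=\mathbf{M}_{r_1}\otimes\cdots\otimes\mathbf{M}_{r_n}$. Component decoders. A deletion-correcting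 algorithm of $\mathcal{C}_{n,l,t}$ is a procedure which, for every codeword and every $J\subseteq[n]$ with $|J|\le t$, given $\mathcal{D}_J$ of the codeword (but not $J$), outputs its message. A single-unitary-error-correcting algorithm of $\mathcal{C}_0$ is a quantum operation which outputs the message from any state obtained from a codeword of $\mathcal{C}_0$ by applying an arbitrary $l\times l$ unitary to one (unknown) qudit. Both are known to exist when $t\ge2$ (any $2s$-erasure-correcting quantum code corrects $s$ unitary errors); fix one of each. Indel matrix. For $\boldsymbol{x}\in\mathbb{Z}_q^n,\boldsymbol{y}\in\mathbb{Z}_q^m$, $\mathbf{H}_{\boldsymbol x,\boldsymbol y}=(h_{i,j})_{0\le i\le n,0\le j\le m}$ is defined by $h_{i,0}=i$, $h_{0,j}=j$, and $h_{i,j}=\min\{h_{i,j-1}+1,\ h_{i-1,j}+1,\ h_{i-1,j-1}+2\cdot\mathbf{1}\{x_i\ne y_j\}\}$ for $i,j\ge1$. Subroutine 1 (input $\boldsymbol x,\boldsymbol y,\mathbf{H}_{\boldsymbol x,\boldsymbol y}$; output $S_1\subseteq[m]$): start with $i=n$, $j=m$, $S_1=\emptyset$. While $i\ge1$ or $j\ge1$: if $i\ge1$ and $h_{i,j}=h_{i-1,j}+1$, set $i\gets i-1$; else if $i,j\ge1$ and $x_i=y_j$, set $i\gets i-1$, $j\gets j-1$; else if $j\ge1$ and $h_{i,j}=h_{i,j-1}+1$, set $S_1\gets S_1\cup\{j\}$, $j\gets j-1$. Subroutine 2 (output $S_2\subseteq[m]$): start with $i=n$, $j=m$, $S_2=\emptyset$.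 While $i\ge1$ or $j\ge1$: if $j\ge1$ and $h_{i,j}=h_{i,j-1}+1$, set $S_2\gets S_2\cup\{j\}$, $j\gets j-1$; else if $i,j\ge1$ and $x_i=y_j$, set $i\gets i-1$, $j\gets j-1$; else if $i\ge1$ and $h_{i,j}=h_{i-1,j}+1$, set $i\gets i-1$. Decoding algorithm (input $\rho\in\mathscr{L}^{(1)}(|\psi\rangle)$): (1) Perform $\mathcal{M}_t$ on each qudit of $\rho$; let $\sigma$ be the post-measurement state and $\boldsymbol r$ the result sequence. If $\boldsymbol r=\boldsymbol m$ go to (2), otherwise go to (3). (2) Output the state obtained by applying the single-unitary-error-correcting algorithm of $\mathcal{C}_0$ to $\sigma$ (where $\sigma$, whose $i$th qudit is supported on the range of $\eta_{m_i}$, is regarded as a state in $S(\mathcal{H}_l^{\otimes n})$ by inverting $\eta_{m_i}$ on the $i$th qudit for every $i$), and stop. (3) Compute $\mathbf{H}_{\boldsymbol m,\boldsymbol r}$. (4) Compute $S_1$ and $S_2$ by Subroutines 1 and 2 with input $\boldsymbol m,\boldsymbol r,\mathbf{H}_{\boldsymbol m,\boldsymbol r}$. (5) Form $\mathcal{D}_{S_1\cup S_2}(\sigma)$. (6) Output the state obtained by applying the deletion-correcting algorithm of $\mathcal{C}_{n,l,t}$ to $\mathcal{D}_{S_1\cup S_2}(\sigma)$. *)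

(* Defs.v *)
From HB Require Import structures.
From mathcomp Require Import all_boot all_order all_algebra.
From mathcomp Require Import sesquilinear spectral.
From mathcomp Require Export reals complex.

Set Implicit Arguments.
Unset Strict Implicit.
Unset Printing Implicit Defensive.

Import Order.TTheory GRing.Theory Num.Theory.
Local Open Scope ring_scope.
Local Open Scope sesquilinear_scope.

(* The computational basis of n qudits of level d is the finite type of words
   {ffun 'I_n -> 'I_d}; MathComp matrices are indexed by ordinals, so a basis
   word stands for its rank in the enumeration of that type. *)
Notation word d n := {ffun 'I_n -> 'I_d}.
Notation qdim d n := #|{: word d n}|.

(* Positions and letters are numbered from 0: position i : 'I_n is the
   (i+1)-st qudit. *)

Section Quantum.
Variable C : numClosedFieldType.

Definition wmatrix (d' n' d n : nat) (f : word d' n' -> word d n -> C) :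
    'M[C]_(qdim d' n', qdim d n) :=
  \matrix_(a, b) f (enum_val a) (enum_val b).

Definition wentry (d' n' d n : nat) (A : 'M[C]_(qdim d' n', qdim d n))
    (x : word d' n') (y : word d n) : C :=
  A (enum_rank x) (enum_rank y).

Definition tensor (d' d n : nat) (A : 'I_n -> 'M[C]_(d', d)) :
    'M[C]_(qdim d' n, qdim d n) :=
  wmatrix (fun x y => \prod_(i < n) A i (x i) (y i)).

Definition isometry (N' N : nat) (V : 'M[C]_(N', N)) : Prop :=
  V^t* *m V = 1%:M.

Definition unit_vector (N : nat) (v : 'cV[C]_N) : Prop :=
  v^t* *m v = 1%:M.

Definition pure (N : nat) (v : 'cV[C]_N) : 'M[C]_N := v *m v^t*.

(* In a numClosedFieldType, 0 <= z entails that z is real; hence the first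
   condition also forces rho to be Hermitian. *)
Definition density (N : nat) (rho : 'M[C]_N) : Prop :=
  (forall v : 'cV[C]_N, 0 <= (v^t* *m rho *m v) 0 0) /\ \tr rho = 1.

(* Completely positive trace-preserving maps, in operator-sum form. *)
Definition quantum_operation (N N' : nat) (Phi : 'M[C]_N -> 'M[C]_N') : Prop :=
  exists (k : nat) (K : 'I_k -> 'M[C]_(N', N)),
    \sum_(i < k) (K i)^t* *m K i = 1%:M /\
    forall A, Phi A = \sum_(i < k) K i *m A *m (K i)^t*.

(* enum_val enumerates the complement of J in increasing order, so the
   remaining qudits keep their order. The number m of remaining qudits is a
   parameter, with a proof e of its value, in order that the result can be
   typed, e.g., with n rather than #|~: [set j]| qudits when j : 'I_n.+1. *)
Definition kept (n m : nat) (J : {set 'I_n}) (e : #|~: J| = m) (k : 'I_m) :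
    'I_n :=
  enum_val (cast_ord (esym e) k).

Definition subword (d n m : nat) (J : {set 'I_n}) (e : #|~: J| = m)
    (x : word d n) : word d m :=
  [ffun k => x (kept e k)].

Definition deletion (d n m : nat) (J : {set 'I_n}) (e : #|~: J| = m)
    (rho : 'M[C]_(qdim d n)) : 'M[C]_(qdim d m) :=
  wmatrix (fun a b =>
    \sum_(x | subword e x == a)
      \sum_(y | (subword e y == b) && [forall i in J, x i == y i])
        wentry rho x y).

Definition insertion (d n : nat) (j : 'I_n.+1) (pi : 'M[C]_d)
    (rho : 'M[C]_(qdim d n)) : 'M[C]_(qdim d n.+1) :=
  wmatrix (fun x y =>
    pi (x j) (y j) *
    wentry rho [ffun k => x (lift j k)] [ffun k => y (lift j k)]).

Lemma card_setC1_ord (n : nat) (j : 'I_n.+1) : #|~: [set j]| = n.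
Proof. by rewrite cardsC1 card_ord. Qed.

(* rho belongs to the set of states obtained from rho0 by one insertion
   followed by one deletion. *)
Definition insdel1 (d n : nat) (rho0 rho : 'M[C]_(qdim d n)) : Prop :=
  exists (j1 j2 : 'I_n.+1) (pi : 'M[C]_d), density pi /\
    rho = deletion (card_setC1_ord j1) (insertion j2 pi rho0).

(* A code with messages on u qudits is given by the matrix V of its encoder. *)
Definition erasure_correcting (t l n u : nat)
    (V : 'M[C]_(qdim l n, qdim l u)) : Prop :=
  isometry V /\
  forall J : {set 'I_n}, (#|J| <= t)%N ->
  exists Phi : 'M[C]_(qdim l #|~: J|) -> 'M[C]_(qdim l u),
    quantum_operation Phi /\
    forall mu : 'cV[C]_(qdim l u), unit_vector mu ->
      Phi (deletion (erefl #|~: J|) (pure (V *m mu))) = pure mu.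

Lemma level_proof (l t : nat) (j : 'I_l) (k : 'I_t.+1) :
  (j * t.+1 + k < l * t.+1)%N.
Proof.
apply: (@leq_trans (j.+1 * t.+1)); last by rewrite leq_mul2r ltn_ord orbT.
by rewrite mulSn addnC ltn_add2r.
Qed.

Definition level (l t : nat) (j : 'I_l) (k : 'I_t.+1) : 'I_(l * t.+1) :=
  Ordinal (level_proof j k).

Definition eta (l t : nat) (i : 'I_t.+1) : 'M[C]_(l * t.+1, l) :=
  \matrix_(a, j) (a == level j i)%:R.

Definition meas (l t : nat) (k : 'I_t.+1) : 'M[C]_(l * t.+1) :=
  \sum_(j < l) delta_mx (level j k) (level j k).

Definition meas_word (l t n : nat) (r : n.-tuple 'I_t.+1) :
    'M[C]_(qdim (l * t.+1) n) :=
  tensor (fun i => meas l (tnth r i)).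

Definition mod_seq (t n : nat) : n.-tuple 'I_t.+1 :=
  [tuple inord (i %% t.+1) | i < n].

Definition eta_all (l t n : nat) : 'M[C]_(qdim (l * t.+1) n, qdim l n) :=
  tensor (fun i => eta l (tnth (mod_seq t n) i)).

Definition MH_codeword (t l n u : nat) (V : 'M[C]_(qdim l n, qdim l u))
    (mu : 'cV[C]_(qdim l u)) : 'cV[C]_(qdim (l * t.+1) n) :=
  eta_all l t n *m (V *m mu).

(* The decoder sees the number m of received qudits, but not which positions
   were deleted. *)
Definition deletion_decoder (t l n u : nat) (V : 'M[C]_(qdim l n, qdim l u))
    (Del : forall m, 'M[C]_(qdim (l * t.+1) m) -> 'M[C]_(qdim l u)) : Prop :=
  forall mu : 'cV[C]_(qdim l u), unit_vector mu ->
  forall J : {set 'I_n}, (#|J| <= t)%N ->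
    Del #|~: J| (deletion (erefl #|~: J|) (pure (MH_codeword t V mu))) = pure mu.

Definition unitary_decoder (l n u : nat) (V : 'M[C]_(qdim l n, qdim l u))
    (Uni : 'M[C]_(qdim l n) -> 'M[C]_(qdim l u)) : Prop :=
  quantum_operation Uni /\
  forall mu : 'cV[C]_(qdim l u), unit_vector mu ->
  forall (k : 'I_n) (U : 'M[C]_l), U \is unitarymx ->
    Uni (pure (tensor (fun i => if i == k then U else 1%:M) *m (V *m mu))) =
    pure mu.

End Quantum.

Section Indel.
Variables (q n m : nat) (x : n.-tuple 'I_q.+1) (y : m.-tuple 'I_q.+1).

(* The entry h_(i, j), with 0 <= i <= n and 0 <= j <= m. The i-th letter of x
   counted from 1 is nth ord0 x i.-1. *)
Fixpoint indel (i j : nat) {struct i} : nat :=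
  if i is i'.+1 then
    (fix row (j : nat) : nat :=
      if j is j'.+1 then
        minn (minn (row j').+1 (indel i' j).+1)
             (indel i' j' + 2 * (nth ord0 x i' != nth ord0 y j'))%N
      else i) j
  else j.

Variable h : nat -> nat -> nat.

(* The state of a subroutine is ((i, j), P), where i and j keep their values
   in 0..n and 0..m; the position j counted from 1 is the element j.-1 of
   'I_m. *)
Definition loop_state : Type := nat * nat * {set 'I_m}.

Definition add_pos (S : {set 'I_m}) (j : nat) : {set 'I_m} :=
  S :|: [set k : 'I_m | k.+1 == j].

Definition step1 (s : loop_state) : loop_state :=
  let: (i, j, P) := s in
  if (0 < i)%N && (h i j == (h i.-1 j).+1) then (i.-1, j, P)
  else if [&& (0 < i)%N, (0 < j)%N & nth ord0 x i.-1 == nth ord0 y j.-1]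
    then (i.-1, j.-1, P)
  else if (0 < j)%N && (h i j == (h i j.-1).+1) then (i, j.-1, add_pos P j)
  else s.

Definition step2 (s : loop_state) : loop_state :=
  let: (i, j, P) := s in
  if (0 < j)%N && (h i j == (h i j.-1).+1) then (i, j.-1, add_pos P j)
  else if [&& (0 < i)%N, (0 < j)%N & nth ord0 x i.-1 == nth ord0 y j.-1]
    then (i.-1, j.-1, P)
  else if (0 < i)%N && (h i j == (h i.-1 j).+1) then (i.-1, j, P)
  else s.

(* Every pass decreases i + j, and steps fix the states with i = j = 0; so
   n + m passes run the loop to completion. *)
Definition run (step : loop_state -> loop_state) : loop_state :=
  iter (n + m) step (n, m, set0).

Definition subroutine1 : {set 'I_m} := (run step1).2.
Definition subroutine2 : {set 'I_m} := (run step2).2.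

End Indel.

Arguments indel : simpl never.

Section Termination.
Variables (q n m : nat) (x : n.-tuple 'I_q.+1) (y : m.-tuple 'I_q.+1).
Local Notation h := (indel x y).

Lemma indel0n (j : nat) : h 0 j = j. Proof. by []. Qed.
Lemma indeln0 (i : nat) : h i 0 = i. Proof. by case: i. Qed.
Lemma indelSS (i j : nat) : h i.+1 j.+1 =
  minn (minn (h i.+1 j).+1 (h i j.+1).+1)
       (h i j + 2 * (nth ord0 x i != nth ord0 y j))%N.
Proof. by []. Qed.

Lemma indel_neq (i j : nat) : nth ord0 x i != nth ord0 y j ->
  (h i.+1 j.+1 == (h i.+1 j).+1) || (h i.+1 j.+1 == (h i j.+1).+1).
Proof.
move=> neq.
have le1 : (h i j.+1 <= (h i j).+1)%N.
  by case: i {neq} => [|i]; rewrite ?indel0n // indelSS !geq_min leqnn.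
have -> : h i.+1 j.+1 = minn (h i.+1 j).+1 (h i j.+1).+1.
  rewrite indelSS neq muln1 addn2; apply/minn_idPl.
  by rewrite geq_min !ltnS le1 orbT.
by rewrite /minn; case: ifP; rewrite eqxx ?orbT.
Qed.

Lemma iter_terminates (step : loop_state m -> loop_state m) :
  (forall i j P, (0 < i + j)%N ->
     ((step (i, j, P)).1.1 + (step (i, j, P)).1.2 < i + j)%N) ->
  (forall P, step (0, 0, P)%N = (0, 0, P)%N) ->
  (run n step).1 = (0, 0)%N.
Proof.
move=> dec fix0; rewrite /run.
suff aux k i j P : (i + j <= k)%N -> (iter k step (i, j, P)).1 = (0, 0)%N.
  exact: aux.
elim: k i j P => [|k IHk] i j P; first by case: i j => [|i] [|j].
move=> le_k; rewrite iterSr.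
case: (posnP (i + j)) => [|gt0].
  by case: i j {le_k} => [|i] [|j] // _; rewrite fix0 IHk.
have := dec i j P gt0; case: (step _) => [[i1 j1] P1] /= lt; apply: IHk.
by rewrite -ltnS (leq_trans lt).
Qed.

Lemma subroutine1_terminates : (run n (step1 x y h)).1 = (0, 0)%N.
Proof.
apply: iter_terminates => // -[|i] [|j] P // _ /=.
- by rewrite !indel0n eqxx /= ltnS.
- by rewrite !indeln0 eqxx /= ltnS.
case: ifP => [_|ne1] /=; first by rewrite addSn.
case: ifP => [_|/negbT ne2] /=; first by rewrite addSn addnS ltnS leqnSn.
by have:= indel_neq ne2; rewrite ne1 orbF => ->; rewrite /= addnS.
Qed.

Lemma subroutine2_terminates : (run n (step2 x y h)).1 = (0, 0)%N.
Proof.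
apply: iter_terminates => // -[|i] [|j] P // _ /=.
- by rewrite !indel0n eqxx /= ltnS.
- by rewrite !indeln0 eqxx /= ltnS.
case: ifP => [_|ne1] /=; first by rewrite addnS.
case: ifP => [_|/negbT ne2] /=; first by rewrite addSn addnS ltnS leqnSn.
by have:= indel_neq ne2; rewrite ne1 /= => ->; rewrite /= addSn.
Qed.

End Termination.

Section Decoding.
Variable C : numClosedFieldType.

Definition outcome_prob (l t n : nat) (rho : 'M[C]_(qdim (l * t.+1) n))
    (r : n.-tuple 'I_t.+1) : C :=
  \tr (meas_word C l r *m rho).

Definition post_state (l t n : nat) (rho : 'M[C]_(qdim (l * t.+1) n))
    (r : n.-tuple 'I_t.+1) : 'M[C]_(qdim (l * t.+1) n) :=
  (outcome_prob rho r)^-1 *: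
    (meas_word C l r *m rho *m (meas_word C l r)^t*).

(* The output when the measurement results are r. The adjoint of the isometry
   eta_all inverts it on its range. *)
Definition decode (l t n u : nat)
    (Del : forall m, 'M[C]_(qdim (l * t.+1) m) -> 'M[C]_(qdim l u))
    (Uni : 'M[C]_(qdim l n) -> 'M[C]_(qdim l u))
    (rho : 'M[C]_(qdim (l * t.+1) n)) (r : n.-tuple 'I_t.+1) :
    'M[C]_(qdim l u) :=
  let sigma := post_state rho r in
  let m := mod_seq t n in
  if r == m then
    Uni ((eta_all C l t n)^t* *m sigma *m eta_all C l t n)
  else
    let h := indel m r in
    let S := subroutine1 m r h :|: subroutine2 m r h in
    Del #|~: S| (deletion (erefl #|~: S|) sigma).

End Decoding.

(* Main.v *)
Require Import Defs.
From mathcomp Require Import all_boot all_order all_algebra.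
From mathcomp Require Import all_fingroup sesquilinear spectral zify ring.

Set Implicit Arguments.
Unset Strict Implicit.
Unset Printing Implicit Defensive.

Import Order.TTheory GRing.Theory Num.Theory.
Local Open Scope ring_scope.
Local Open Scope sesquilinear_scope.

(* Unless the insertion and the deletion cancel, the received state is, up to
   a monotone relocation of the qudits, the codeword with its q-th qudit
   replaced by an independent one, which sits at some position p. The result
   sequence r is then m with its q-th letter removed and an arbitrary letter
   inserted at the position p.

   If r = m, then p = q, because neighbouring letters of m differ; the decoder
   sees an error on a single qudit, and an operation which corrects all unitary
   errors there corrects it, by linearity of its Kraus operators.

   If r <> m, the indel distance of m and r is 2, so each subroutine records at
   most one position. As letters of m at distance 1 or 2 differ (t >= 2), the
   only ambiguity on the insertion is whether it happened at p or at one
   position next to it; the subroutines resolve ties in opposite ways, so that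
   one of them records p. Removing S_1 and S_2 thus leaves the codeword with
   at most 2 <= t deletions. *)

(** * Indel distance and the two subroutines *)

Section IndelDistance.
Local Open Scope nat_scope.
Variables (q n m : nat) (x : n.-tuple 'I_q.+1) (y : m.-tuple 'I_q.+1).
Local Notation h := (indel x y).
Local Notation X := (nth ord0 x).
Local Notation Y := (nth ord0 y).

Lemma indel_leSl i j : (h i.+1 j <= (h i j).+1)%N.
Proof. by case: j => [|j]; rewrite ?indeln0 // indelSS; lia. Qed.

Lemma indel_leSr i j : (h i j.+1 <= (h i j).+1)%N.
Proof. by case: i => [|i]; rewrite ?indel0n // indelSS; lia. Qed.

Lemma indel_geSl i j : (h i j <= (h i.+1 j).+1)%N.
Proof.
elim: j => [|j IHj]; rewrite ?indeln0 ?indelSS; first by lia.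
by move: (indel_leSr i j); lia.
Qed.

Lemma indel_geSr i j : (h i j <= (h i j.+1).+1)%N.
Proof.
elim: i => [|i IHi]; rewrite ?indel0n ?indelSS; first by lia.
by move: (indel_leSl i j); lia.
Qed.

(** Neighbouring entries differ by at most one, so at equal letters neither an insertion nor a
    deletion beats the diagonal move. *)
Lemma indel_match i j : X i = Y j -> h i.+1 j.+1 = h i j.
Proof.
by move=> e; rewrite indelSS e eqxx; move: (indel_geSl i j) (indel_geSr i j); lia.
Qed.

(** Insertions and deletions cost 1, diagonal moves 0 or 2. This parity excludes the value 1 on the
    main diagonal. *)
Lemma odd_indel i j : odd (h i j) = odd (i + j).
Proof.
elim: i j => [|i IHi] j; first by rewrite indel0n.
elim: j => [|j IHj]; first by rewrite indeln0 addn0.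
have odd_minn a b c : odd a = c -> odd b = c -> odd (minn a b) = c.
  by rewrite /minn; case: ifP.
rewrite indelSS; apply: (odd_minn); last first.
  by rewrite oddD mul2n odd_double addbF IHi addSn addnS /= negbK.
by apply: odd_minn; rewrite /= ?IHj ?IHi ?addSn ?addnS /= ?negbK.
Qed.

Lemma indel_geB i j : (i - j <= h i j)%N /\ (j - i <= h i j)%N.
Proof.
elim: i j => [|i IHi] j; first by rewrite indel0n; lia.
elim: j => [|j IHj]; first by rewrite indeln0; lia.
by rewrite indelSS; move: (IHi j) (IHi j.+1) IHj; lia.
Qed.

Lemma indel_diag i : (forall k, k < i -> X k = Y k) -> h i i = 0.
Proof.
elim: i => [|i IHi] e; first by rewrite indel0n.
by rewrite indel_match ?IHi // => [k ki|]; apply: e; lia.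
Qed.

Lemma indel_diag0 i : h i i = 0 -> forall k, k < i -> X k = Y k.
Proof.
elim: i => [//|i IHi]; rewrite indelSS => h0 k ki.
have {h0} [hii e] : h i i = 0 /\ X i = Y i.
  by case: eqP h0 => ?; split=> //; lia.
by case: (ltngtP k i) => [|/(leq_trans ki)|->//]; [exact: IHi | lia].
Qed.

(** By induction: the last letter of the prefix of [y] is either the inserted one, with diagonal
    entry 0 before it, or it is matched. A deletion would come from an entry that is at least 2. *)
Lemma indel_insertion i : h i i.+1 <= 1 -> exists2 p, p <= i &
  (forall k, k < p -> X k = Y k) /\ (forall k, p <= k < i -> X k = Y k.+1).
Proof.
elim: i => [|i IHi]; first by exists 0 => //; split=> k; lia.
rewrite indelSS => hle.
have [] : h i.+1 i.+1 = 0 \/ (h i i.+1 <= 1 /\ X i = Y i.+1).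
- move: (indel_geB i i.+2) hle; case: eqP => ? ? ?; last by left; lia.
  by case: (h i.+1 i.+1 =P 0) => ?; [left | right; split=> //; lia].
- by exists i.+1 => //; split=> [|k]; [exact: indel_diag0 | lia].
move=> [/IHi [p pi [e1 e2]] e]; exists p; first exact: leqW.
by split=> // k kp; case: (k =P i) => [->//|?]; apply: e2; lia.
Qed.

Lemma indel_deletion i : h i.+1 i <= 1 -> exists2 p, p <= i &
  (forall k, k < p -> X k = Y k) /\ (forall k, p <= k < i -> X k.+1 = Y k).
Proof.
elim: i => [|i IHi]; first by exists 0 => //; split=> k; lia.
rewrite indelSS => hle.
have [] : h i.+1 i.+1 = 0 \/ (h i.+1 i <= 1 /\ X i.+1 = Y i).
- move: (indel_geB i.+2 i) hle; case: eqP => ? ? ?; last by left; lia.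
  by case: (h i.+1 i.+1 =P 0) => ?; [left | right; split=> //; lia].
- by exists i.+1 => //; split=> [|k]; [exact: indel_diag0 | lia].
move=> [/IHi [p pi [e1 e2]] e]; exists p; first exact: leqW.
by split=> // k kp; case: (k =P i) => [->//|?]; apply: e2; lia.
Qed.

Lemma indel_insertion_le p i : p <= i -> (forall k, k < p -> X k = Y k) ->
  (forall k, p <= k < i -> X k = Y k.+1) -> h i i.+1 <= 1.
Proof.
elim: i => [|i IHi] pi e1 e2; first by rewrite indel0n.
case: (p =P i.+1) => [pE|?].
  by apply: leq_trans (indel_leSr _ _) _; rewrite indel_diag // -pE.
by rewrite indel_match ?IHi //; [lia | move=> k ?; apply: e2; lia | apply: e2; lia].
Qed.

Lemma indel_deletion_le p i : p <= i -> (forall k, k < p -> X k = Y k) ->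
  (forall k, p <= k < i -> X k.+1 = Y k) -> h i.+1 i <= 1.
Proof.
elim: i => [|i IHi] pi e1 e2; first by rewrite indeln0.
case: (p =P i.+1) => [pE|?].
  by apply: leq_trans (indel_leSl _ _) _; rewrite indel_diag // -pE.
by rewrite indel_match ?IHi //; [lia | move=> k ?; apply: e2; lia | apply: e2; lia].
Qed.

Lemma indel_tail a i : a <= i -> (forall k, a <= k < i -> X k = Y k) ->
  h i i = h a a.
Proof.
elim: i => [|i IHi] ai e; first by have -> : a = 0 by lia.
case: (a =P i.+1) => [->//|?].
by rewrite indel_match ?IHi //; [lia | move=> k ?; apply: e; lia | apply: e; lia].
Qed.


Local Notation recorded s := (snd s : {set 'I_m}).

(** * Runs of the backtracking loops *)

Section Loop.
Variable step : loop_state m -> loop_state m.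
Hypothesis step_sub : forall s, recorded s \subset recorded (step s).

(** All numbers of passes from [i + j] on are covered, because a match lowers [i + j] by 2 and
    leaves spare passes in the fixed count of [run]. *)
Definition yields (k : 'I_m) (s : loop_state m) : Prop :=
  forall N, s.1.1 + s.1.2 <= N -> k \in recorded (iter N step s).

Lemma yields_mem k s : k \in recorded s -> yields k s.
Proof.
move=> ks N _; elim: N => //= N; exact/subsetP.
Qed.

Lemma yields_step k s s' : step s = s' -> s'.1.1 + s'.1.2 < s.1.1 + s.1.2 ->
  yields k s' -> yields k s.
Proof.
by move=> <- lt ys [|N] le; [lia | rewrite iterSr; apply: ys; lia].
Qed.

(* The potential h(i, j) + j - i is unchanged by the two kinds of moves which
   decrease i, and drops by 2 when a position is recorded. *)
Definition potential_step : Prop := forall i j P i' j' P',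
  step (i, j, P) = (i', j', P') ->
  2 * #|P'| + h i' j' + j' + i <= 2 * #|P| + h i j + j + i'.

(** The potential telescopes from [(n, m)] to [(0, 0)], where it is 0. For [n = m] and distance 2
    this leaves room for one recorded position. *)
Lemma card_run : potential_step -> (run n step).1 = (0, 0) ->
  2 * #|recorded (run n step)| + n <= h n m + m.
Proof.
move=> pot; rewrite /run; move: (n + m) => N.
have: 2 * #|recorded (iter N step (n, m, set0))| + h (iter N step (n, m, set0)).1.1
   (iter N step (n, m, set0)).1.2 + (iter N step (n, m, set0)).1.2 + n
   <= h n m + m + (iter N step (n, m, set0)).1.1.
  elim: N => [|N] /=; first by rewrite cards0; lia.
  case: (iter N step _) => [[i j] P] /=.
  case: (step (i, j, P)) (pot i j P) => [[i' j'] P'] /(_ i' j' P' erefl) /=.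
  by lia.
by move=> + e; rewrite e /= indel0n; lia.
Qed.
End Loop.

Lemma add_posS (P : {set 'I_m}) (k : 'I_m) : add_pos P k.+1 = k |: P.
Proof. by apply/setP=> a; rewrite !inE eqSS orbC. Qed.

Lemma card_add_pos (P : {set 'I_m}) j : #|add_pos P j| <= #|P|.+1.
Proof.
apply: leq_trans (leq_card_setU _ _) _; rewrite -addn1 leq_add2l.
by apply/card_le1_eqP => a b; rewrite !inE => /eqP <- /eqP [] /val_inj.
Qed.

Lemma sub_add_pos (P : {set 'I_m}) j : P \subset add_pos P j.
Proof. exact: subsetUl. Qed.

Local Notation step1 := (step1 x y h).
Local Notation step2 := (step2 x y h).

Lemma step1_sub s : recorded s \subset recorded (step1 s).
Proof.
by case: s => [[i j] P] /=; do 3?[case: ifP => _ //=]; rewrite ?sub_add_pos.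
Qed.

Lemma step2_sub s : recorded s \subset recorded (step2 s).
Proof.
by case: s => [[i j] P] /=; do 3?[case: ifP => _ //=]; rewrite ?sub_add_pos.
Qed.

Lemma step1_potential : potential_step step1.
Proof.
move=> i j P i' j' P' /=.
case: ifP => [/andP[i0 /eqP e] [<- <- <-]|_]; first by lia.
case: ifP => [/and3P[i0 j0 /eqP e] [<- <- <-]|_].
  by case: i j i0 j0 e => [|i] [|j] //= _ _ /indel_match ->; lia.
case: ifP => [/andP[i0 /eqP e] [<- <- <-]|_ [<- <- <-] //].
by move: (card_add_pos P j); move: #|add_pos P j| #|P| => b c; lia.
Qed.

Lemma step2_potential : potential_step step2.
Proof.
move=> i j P i' j' P' /=.
case: ifP => [/andP[i0 /eqP e] [<- <- <-]|_].
  by move: (card_add_pos P j); move: #|add_pos P j| #|P| => b c; lia.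
case: ifP => [/and3P[i0 j0 /eqP e] [<- <- <-]|_].
  by case: i j i0 j0 e => [|i] [|j] //= _ _ /indel_match ->; lia.
by case: ifP => [/andP[i0 /eqP e] [<- <- <-]|_ [<- <- <-] //]; lia.
Qed.

Lemma card_subroutine1 : 2 * #|subroutine1 x y h| + n <= h n m + m.
Proof. exact: card_run step1_potential (subroutine1_terminates x y). Qed.

Lemma card_subroutine2 : 2 * #|subroutine2 x y h| + n <= h n m + m.
Proof. exact: card_run step2_potential (subroutine2_terminates x y). Qed.

Lemma mem_subroutine1 k : yields step1 k (n, m, set0) ->
  k \in subroutine1 x y h.
Proof. by apply. Qed.

Lemma mem_subroutine2 k : yields step2 k (n, m, set0) ->
  k \in subroutine2 x y h.
Proof. by apply. Qed.

Lemma yields1_del k i j P : h i.+1 j = (h i j).+1 ->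
  yields step1 k (i, j, P) -> yields step1 k (i.+1, j, P).
Proof. by move=> e; apply: yields_step => //=; rewrite e eqxx. Qed.

Lemma yields1_match k i j P : h i.+1 j.+1 <> (h i j.+1).+1 -> X i = Y j ->
  yields step1 k (i, j, P) -> yields step1 k (i.+1, j.+1, P).
Proof.
move=> /eqP/negbTE ne e; apply: yields_step => /=; last by lia.
by rewrite ne e eqxx.
Qed.

(** Recording is the last choice of Subroutine 1, so the second hypothesis rules out the deletion
    and the match; Subroutine 2 tries recording first. *)
Lemma yields1_ins (k : 'I_m) i P : h i k.+1 = (h i k).+1 ->
  (0 < i -> h i k.+1 <> (h i.-1 k.+1).+1 /\ X i.-1 <> Y k) ->
  yields step1 k (i, k.+1, P).
Proof.
move=> e ne; apply: (@yields_step _ _ _ (i, nat_of_ord k, k |: P)); last first.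
- by apply: yields_mem step1_sub _ _ _; rewrite setU11.
- by rewrite /=; lia.
rewrite /= -add_posS e eqxx; case: posnP => [->//|/ne]; rewrite e.
by move=> [/eqP/negbTE -> /eqP/negbTE ->].
Qed.

Lemma yields2_ins (k : 'I_m) i P : h i k.+1 = (h i k).+1 ->
  yields step2 k (i, k.+1, P).
Proof.
move=> e; apply: (@yields_step _ _ _ (i, nat_of_ord k, k |: P)); last first.
- by apply: yields_mem step2_sub _ _ _; rewrite setU11.
- by rewrite /=; lia.
by rewrite /= -add_posS e eqxx.
Qed.

Lemma yields2_match k i j P : h i.+1 j.+1 <> (h i.+1 j).+1 -> X i = Y j ->
  yields step2 k (i, j, P) -> yields step2 k (i.+1, j.+1, P).
Proof.
move=> /eqP/negbTE ne e; apply: yields_step => /=; last by lia.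
by rewrite ne e eqxx.
Qed.

Lemma yields2_del k i j P : h i.+1 j.+1 <> (h i.+1 j).+1 -> X i <> Y j ->
  yields step2 k (i, j.+1, P) -> yields step2 k (i.+1, j.+1, P).
Proof.
move=> ne /eqP/negbTE ne'; apply: yields_step => /=; last by lia.
have := indel_neq (negbT ne'); move/eqP/negbTE: ne => -> /= ->.
by rewrite ne'.
Qed.

End IndelDistance.

(** * The subroutines after the relocation of one letter *)

Section Relocation.
Local Open Scope nat_scope.
Variables (a n : nat) (x y : n.-tuple 'I_a.+1).
Local Notation h := (indel x y).
Local Notation X := (nth ord0 x).
Local Notation Y := (nth ord0 y).
Variables (p q : 'I_n).
(* y is x with the letter at q deleted and a letter inserted at p; the letters
   in between are shifted by one. *)
Hypothesis X1 : forall i, i.+1 < n -> X i <> X i.+1.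
Hypothesis X2 : forall i, i.+2 < n -> X i <> X i.+2.
Hypothesis XY : forall i, i < n -> i < minn p q \/ maxn p q < i -> X i = Y i.
Hypothesis XYl : forall i, p <= i < q -> X i = Y i.+1.
Hypothesis XYr : forall i, q <= i < p -> X i.+1 = Y i.
Hypothesis xy : x <> y.

Let pn : p < n. Proof. exact: ltn_ord. Qed.
Let qn : q < n. Proof. exact: ltn_ord. Qed.

Lemma relocation_diff : exists2 i, i <= maxn p q & X i <> Y i.
Proof.
case: (altP (@forallP 'I_n (fun i => X i == Y i))) => [/= e|].
  by case: xy; apply/eq_from_tnth => i; rewrite !(tnth_nth ord0); apply/eqP.
move=> /forallPn [i /eqP ne]; exists (i : nat) => //.
by rewrite leqNgt; apply/negP => ?; apply: ne; apply: XY => //; right.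
Qed.

Lemma indel_shiftl i : p <= i <= q -> h i i.+1 = 1.
Proof.
move=> /andP[pi iq]; suff: h i i.+1 <= 1 by move: (indel_geB x y i i.+1); lia.
apply: (indel_insertion_le pi) => k kp; first by apply: XY; lia.
by apply: XYl; lia.
Qed.

Lemma indel_shiftr i : q <= i <= p -> h i.+1 i = 1.
Proof.
move=> /andP[qi ip]; suff: h i.+1 i <= 1 by move: (indel_geB x y i.+1 i); lia.
apply: (indel_deletion_le qi) => k kq; first by apply: XY; lia.
by apply: XYr; lia.
Qed.

(** One insertion and one deletion give at most 2; the words differ, so the value is not 0, and it
    is even. Past both positions the letters match, which keeps it constant. *)
Lemma indel_relocation i : maxn p q < i <= n -> h i i = 2.
Proof.
move=> /andP[Mi ilen].
have h2 : h (maxn p q).+1 (maxn p q).+1 = 2.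
  have [k kM ne] := relocation_diff.
  have ge1 : h (maxn p q).+1 (maxn p q).+1 <> 0.
    by move=> /indel_diag0 e; apply: ne; apply: e.
  suff: h (maxn p q).+1 (maxn p q).+1 <= 2.
    by have := odd_indel x y (maxn p q).+1 (maxn p q).+1; lia.
  case: (leqP p q) => pq.
    by have := indel_leSl x y q q.+1; rewrite indel_shiftl ?pq ?leqnn.
  have := indel_leSr x y p.+1 p.
  by rewrite indel_shiftr // (ltnW pq) leqnn.
rewrite (indel_tail Mi) // => k /andP[Mk ki]; apply: XY; lia.
Qed.

(** At [(i.+1, i.+1)] the entry is 2 and the letters match. The only rival to the match is a
    deletion, which needs [h i i.+1 = 1]; without it the run follows the diagonal down to [i0]. *)
Lemma descent1 k P i0 : maxn p q < i0 <= n ->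
  (forall i, i0 <= i < n -> ~ h i i.+1 <= 1) ->
  yields (step1 x y h) k (i0, i0, P) -> yields (step1 x y h) k (n, n, P).
Proof.
move=> /andP[Mi0 i0n] nins y0.
suff: forall i, i0 <= i <= n -> yields (step1 x y h) k (i, i, P).
  by apply; rewrite i0n leqnn.
elim=> [|i IHi] ilen; first by have -> : 0 = i0 by lia.
case: (i0 =P i.+1) => [<-//|?]; apply: yields1_match; last by apply: IHi; lia.
  by rewrite indel_relocation; [move: (nins i); lia | lia].
by apply: XY; lia.
Qed.

(** Here the rival to the match is an insertion, which needs [h i.+1 i = 1]. *)
Lemma descent2 k P i0 : maxn p q < i0 <= n ->
  (forall i, i0 <= i < n -> ~ h i.+1 i <= 1) ->
  yields (step2 x y h) k (i0, i0, P) -> yields (step2 x y h) k (n, n, P).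
Proof.
move=> /andP[Mi0 i0n] ndel y0.
suff: forall i, i0 <= i <= n -> yields (step2 x y h) k (i, i, P).
  by apply; rewrite i0n leqnn.
elim=> [|i IHi] ilen; first by have -> : 0 = i0 by lia.
case: (i0 =P i.+1) => [<-//|?]; apply: yields2_match; last by apply: IHi; lia.
  by rewrite indel_relocation; [move: (ndel i); lia | lia].
by apply: XY; lia.
Qed.

(* If X p.-1 = Y p, Subroutine 1 matches these letters and records the position
   before p, whereas Subroutine 2 prefers to record p. *)
Lemma mem_subroutine1_left : p <= q -> (0 < p -> X p.-1 <> Y p) ->
  p \in subroutine1 x y h.
Proof.
move=> pq ne.
apply: mem_subroutine1; apply: (@descent1 _ _ q.+1); first by lia.
  (* A single insertion would come no later than the discrepancy [k <= q], whence
     [X q = Y q.+1 = X q.+1]. *)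
  move=> i iq /indel_insertion [p' p'i [e1 e2]].
  have [k kM kne] := relocation_diff.
  have p'k : p' <= k by rewrite leqNgt; apply/negP => /e1.
  by apply: (X1 (i := q)); [lia | rewrite (e2 q) ?XY //; lia].
(* Deleting the letter at [q] leads to [(q, q.+1)]; matches then lead down the off-diagonal to
   [(p, p.+1)], where [p] is recorded. *)
apply: yields1_del; first by rewrite indel_relocation ?indel_shiftl; lia.
suff: forall j, p <= j <= q -> yields (step1 x y h) p (j, j.+1, set0).
  by apply; rewrite pq leqnn.
have ins : yields (step1 x y h) p (nat_of_ord p, p.+1, set0).
  apply: yields1_ins => [|p0].
    rewrite indel_shiftl ?indel_diag ?pq ?leqnn // => k kp; apply: XY; lia.
  split; last exact: ne.
  by rewrite indel_shiftl ?pq ?leqnn //; move: (indel_geB x y p.-1 p.+1); lia.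
elim=> [|j IHj] pjq; first by have -> : 0 = p by lia.
case: (p =P j.+1 :> nat) => [<-//|?]; apply: yields1_match.
- by rewrite indel_shiftl //; move: (indel_geB x y j j.+2); lia.
- by apply: XYl; lia.
- by apply: IHj; lia.
Qed.

Lemma mem_subroutine2_left : p <= q -> 0 < p -> X p.-1 = Y p ->
  p \in subroutine2 x y h.
Proof.
move=> pq p0 e.
have nep : X p <> Y p.
  by move=> e'; apply: (X1 (i := p.-1)); rewrite prednK // e e'.
(* Letters at distance 2 matter here: [p' <= p] gives [X p.+1 = Y p = X p.-1]. *)
have ndel i : p < i < n -> ~ h i.+1 i <= 1.
  move=> pin /indel_deletion [p' p'i [e1 e2]].
  have p'p : p' <= p by rewrite leqNgt; apply/negP => /e1.
  by apply: (X2 (i := p.-1)); rewrite prednK // ?e ?e2 //; lia.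
have hpp : h p p = 0 by apply: indel_diag => k kp; apply: XY; lia.
apply: mem_subroutine2; apply: (@descent2 _ _ q.+1); first by lia.
  by move=> i iq; apply: ndel; lia.
case: (p =P q) => [pE|pNq].
  rewrite -pE; apply: yields2_ins.
  rewrite indel_relocation -?pE ?maxnn ?leqnn ?pn //.
  by move: (indel_leSl x y p p) (indel_geB x y p.+1 p); rewrite hpp; lia.
have {pNq} pltq : p < q by move/eqP: pNq; rewrite -val_eqE /=; lia.
(* At [(q.+1, q.+1)] recording is excluded by [ndel] and matching by [Y q = X q.-1], so the letter
   of [x] at [q] is deleted. *)
apply: yields2_del.
- by rewrite indel_relocation; [move: (ndel q); lia | lia].
- move=> eq; apply: (X1 (i := q.-1));
  rewrite prednK ?eq ?(XYl (i := q.-1)) ?prednK //; lia.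
suff: forall j, p <= j <= q -> yields (step2 x y h) p (j, j.+1, set0).
  by apply; rewrite pq leqnn.
have ins : yields (step2 x y h) p (nat_of_ord p, p.+1, set0).
  by apply: yields2_ins; rewrite indel_shiftl ?hpp ?pq ?leqnn.
elim=> [|j IHj] pjq; first by have -> : 0 = p by lia.
case: (p =P j.+1 :> nat) => [<-//|?]; apply: yields2_match.
(* Recording a position above [p] would need a zero diagonal entry, against [X p <> Y p]. *)
- rewrite indel_shiftl // => -[/esym /indel_diag0 e'].
  by apply: nep; apply: e'; lia.
- by apply: XYl; lia.
- by apply: IHj; lia.
Qed.

(* If Y p = X p.+1, Subroutine 2 records the position after p, whereas
   Subroutine 1 prefers to match it. *)
Lemma mem_subroutine2_right : q < p -> (p.+1 < n -> Y p <> X p.+1) ->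
  p \in subroutine2 x y h.
Proof.
move=> qp ne.
apply: mem_subroutine2; apply: (@descent2 _ _ p.+1); first by lia.
  (* As [Y q = X q.+1] differs from [X q], a single deletion would come at or before [q] and force
     [X p.+1 = Y p]. *)
  move=> i ip /indel_deletion [p' p'i [e1 e2]].
  have p'q : p' <= q.
    rewrite leqNgt; apply/negP => /e1 e; apply: (X1 (i := q)); first by lia.
    by rewrite e XYr //; lia.
  by apply: ne; [lia | rewrite e2 //; lia].
apply: yields2_ins; rewrite indel_relocation ?indel_shiftr; lia.
Qed.

Lemma mem_subroutine1_right : q < p -> p.+1 < n -> Y p = X p.+1 ->
  p \in subroutine1 x y h.
Proof.
move=> qp p1n e.
(* A single insertion at or before [q] would give [X q = Y q.+1 = X q.+2], against [X2]; for
   [p = q.+1] the second equality is [e]. *)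
have nins i : p <= i < n -> ~ h i i.+1 <= 1.
  move=> pin /indel_insertion [p' p'i [e1 e2]].
  have p'q : p' <= q.
    rewrite leqNgt; apply/negP => /e1 e'; apply: (X1 (i := q)); first by lia.
    by rewrite e' XYr //; lia.
  apply: (X2 (i := q)); first by lia.
  rewrite e2; last by lia.
  by case: (p =P q.+1 :> nat) => [<-//|?]; rewrite XYr //; lia.
apply: mem_subroutine1; apply: (@descent1 _ _ p.+1); first by lia.
  by move=> i ip; apply: nins; lia.
apply: yields1_ins => [|_ /=]; first by rewrite indel_relocation ?indel_shiftr; lia.
split; first by rewrite indel_relocation; [move: (nins p); lia | lia].
by move=> e'; apply: (X1 (i := p)); rewrite // e' e.
Qed.

Lemma mem_subroutines : p \in subroutine1 x y h :|: subroutine2 x y h.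
Proof.
rewrite inE; case: (leqP p q) => pq.
  case: (posnP p) => [p0|p0].
    by rewrite mem_subroutine1_left //; lia.
  case: (X p.-1 =P Y p) => [e|ne]; first by rewrite mem_subroutine2_left ?orbT.
  by rewrite mem_subroutine1_left.
case: (ltnP p.+1 n) => p1n; last by rewrite mem_subroutine2_right ?orbT //; lia.
case: (Y p =P X p.+1) => [e|ne]; first by rewrite mem_subroutine1_right.
by rewrite mem_subroutine2_right ?orbT.
Qed.

Lemma card_subroutines : #|subroutine1 x y h :|: subroutine2 x y h| <= 2.
Proof.
apply: leq_trans (leq_card_setU _ _) _.
have := card_subroutine1 x y; have := card_subroutine2 x y.
rewrite indel_relocation; last by lia.
by move: #|subroutine1 x y h| #|subroutine2 x y h| => b c; lia.
Qed.
End Relocation.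

(** * Words and partial traces *)

Section Kept.
Variables (n m : nat) (J : {set 'I_n}) (e : #|~: J| = m).

Lemma kept_notin k : kept e k \notin J.
Proof. by have := enum_valP (cast_ord (esym e) k); rewrite inE. Qed.

Lemma keptP i : i \notin J -> exists k, i = kept e k.
Proof.
rewrite -in_setC => iJ; exists (cast_ord e (enum_rank_in iJ i)).
by rewrite /kept cast_ordK enum_rankK_in.
Qed.

Lemma sorted_enum_ord (A : {set 'I_n}) :
  sorted (fun i j : 'I_n => (i < j)%N) (enum A).
Proof.
rewrite /enum_mem; apply: sorted_filter; first by move=> ? ? ?; apply: ltn_trans.
have : sorted ltn [seq val k | k <- enum 'I_n].
  by rewrite val_enum_ord iota_ltn_sorted.
by rewrite sorted_map enumT.
Qed.

Lemma kept_lt (k k' : 'I_m) : (k < k')%N -> (kept e k < kept e k')%N.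
Proof.
move=> kk'; have i0 : 'I_n := kept e k.
rewrite /kept !(enum_val_nth i0).
have tr : transitive (fun i j : 'I_n => (i < j)%N) by move=> ? ? ?; apply: ltn_trans.
apply: (sorted_ltn_nth tr i0 (sorted_enum_ord _)) => //;
  by rewrite inE -cardE ltn_ord.
Qed.

(** A set has only one increasing enumeration, and an increasing map from [m] indices into the
    complement of [J] exhausts it by cardinality. *)
Lemma kept_eq (g : 'I_m -> 'I_n) :
  (forall k k' : 'I_m, (k < k')%N -> (g k < g k')%N) ->
  (forall k, g k \notin J) -> kept e =1 g.
Proof.
move=> g_lt gJ.
have g_inj : injective g.
  move=> k k' gk; case: (ltngtP k k') => [/g_lt|/g_lt|/val_inj//];
  by rewrite gk ltnn.
have enumJ : enum (~: J) = [seq g k | k <- enum 'I_m].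
  apply: (irr_sorted_eq (leT := fun i j : 'I_n => (i < j)%N)).
  - by move=> ? ? ?; apply: ltn_trans.
  - by move=> ?; apply: ltnn.
  - exact: sorted_enum_ord.
  - rewrite sorted_map.
    have : sorted ltn [seq val k | k <- enum 'I_m].
      by rewrite val_enum_ord iota_ltn_sorted.
    by rewrite sorted_map; apply: sub_sorted => k k'; apply: g_lt.
  have gE : g @: setT = ~: J.
    apply/eqP; rewrite eqEcard card_imset // cardsT card_ord e leqnn andbT.
    by apply/subsetP => _ /imsetP[k _ ->]; rewrite inE.
  move=> i; rewrite mem_enum -gE; apply/imsetP/mapP => -[k _ ->]; exists k => //.
  exact: mem_enum.
move=> k; rewrite /kept (enum_val_nth (g k)) enumJ (nth_map k) /= ?nth_ord_enum //.
by rewrite size_enum_ord.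
Qed.
End Kept.

Lemma kept_lift n (j : 'I_n.+1) k : kept (card_setC1_ord j) k = lift j k.
Proof.
apply: kept_eq => {}k => [k' kk'|]; last by rewrite inE eq_sym neq_lift.
by rewrite /= /bump; lia.
Qed.

Section Words.
Variables (C : numClosedFieldType) (d : nat).

Lemma wmatrixE d' n' n (f : word d' n' -> word d n -> C) x y :
  wentry (wmatrix f) x y = f x y.
Proof. by rewrite /wentry mxE !enum_rankK. Qed.

Lemma wentryP d' n' n (A B : 'M[C]_(qdim d' n', qdim d n)) :
  (forall x y, wentry A x y = wentry B x y) <-> A = B.
Proof.
split=> [AB|->//]; apply/matrixP => a b.
by have := AB (enum_val a) (enum_val b); rewrite /wentry !enum_valK.
Qed.

Lemma sum_words n (F : 'I_(qdim d n) -> C) :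
  \sum_a F a = \sum_(x : word d n) F (enum_rank x).
Proof. by rewrite (reindex (@enum_rank (word d n))) //; exact/onW_bij/enum_rank_bij. Qed.

Lemma trace_words n (A : 'M[C]_(qdim d n)) : \tr A = \sum_x wentry A x x.
Proof. exact: sum_words. Qed.

Lemma wentry_mul d' d'' n' n'' n (A : 'M[C]_(qdim d' n', qdim d n))
    (B : 'M[C]_(qdim d n, qdim d'' n'')) x y :
  wentry (A *m B) x y = \sum_z wentry A x z * wentry B z y.
Proof. by rewrite /wentry mxE sum_words. Qed.

Lemma wentry_adj d' n' n (A : 'M[C]_(qdim d' n', qdim d n)) x y :
  wentry (A^t*) x y = (wentry A y x)^*.
Proof. by rewrite /wentry !mxE. Qed.

Definition amplitude n (v : 'cV[C]_(qdim d n)) (x : word d n) : C :=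
  v (enum_rank x) 0.

Lemma wentry_pure n (v : 'cV[C]_(qdim d n)) x y :
  wentry (pure v) x y = amplitude v x * (amplitude v y)^*.
Proof. by rewrite /wentry mxE big_ord1 !mxE. Qed.

Lemma trace_deletion n m (J : {set 'I_n}) (e : #|~: J| = m)
    (A : 'M[C]_(qdim d n)) : \tr (deletion e A) = \tr A.
Proof.
rewrite !trace_words.
rewrite [RHS](partition_big (fun x => subword e x) predT) //=.
apply: eq_bigr => a _; rewrite wmatrixE; apply: eq_bigr => x /eqP xa.
rewrite (big_pred1 x) // => y; apply/andP/eqP => [[/eqP ya /forallP xyJ]|->].
  apply/ffunP => i; case: (boolP (i \in J)) => [iJ|/(keptP e) [k ->]].
    by have := xyJ i; rewrite iJ /= => /eqP.
  by have := congr1 (fun f : word d m => f k) (etrans ya (esym xa)); rewrite !ffunE.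
by rewrite xa eqxx; split=> //; apply/forallP => i; apply/implyP.
Qed.

Definition insert_at n (j : 'I_n.+1) (c : 'I_d) (x : word d n) : word d n.+1 :=
  [ffun i => if unlift j i is Some k then x k else c].

Definition replace_at n (j : 'I_n) (c : 'I_d) (x : word d n) : word d n :=
  [ffun i => if i == j then c else x i].

Lemma deletion1E n (j : 'I_n.+1) (A : 'M[C]_(qdim d n.+1)) x y :
  wentry (deletion (card_setC1_ord j) A) x y =
  \sum_c wentry A (insert_at j c x) (insert_at j c y).
Proof.
have ins_at c z : insert_at j c z j = c by rewrite ffunE unlift_none.
have sub_ins c z : subword (card_setC1_ord j) (insert_at j c z) = z.
  by apply/ffunP => k; rewrite !ffunE kept_lift liftK.
have ins_sub (z : word d n.+1) : insert_at j (z j) (subword (card_setC1_ord j) z) = z.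
  apply/ffunP => i; rewrite !ffunE; case: unliftP => [k ->|->//].
  by rewrite ffunE kept_lift.
rewrite wmatrixE (reindex_onto (fun c => insert_at j c x)
  (fun z : word d n.+1 => z j)) /=;
  last by move=> z /eqP <-.
apply: eq_big => [c|c _]; first by rewrite sub_ins ins_at !eqxx.
rewrite (big_pred1 (insert_at j c y)) // => w.
apply/andP/eqP => [[/eqP wy /forallP /(_ j)]|->].
  by rewrite in_set1 eqxx ins_at => /eqP cE; rewrite -wy cE ins_sub.
rewrite sub_ins; split=> //; apply/forallP => i; rewrite in_set1.
by apply/implyP => /eqP ->; rewrite !ins_at.
Qed.

Lemma insertionE n (j : 'I_n.+1) (pi : 'M[C]_d) (A : 'M[C]_(qdim d n)) x y :
  wentry (insertion j pi A) x y = pi (x j) (y j) *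
    wentry A [ffun k => x (lift j k)] [ffun k => y (lift j k)].
Proof. exact: wmatrixE. Qed.

Lemma insdel_same n (j : 'I_n.+1) (pi : 'M[C]_d) (A : 'M[C]_(qdim d n)) :
  \tr pi = 1 -> deletion (card_setC1_ord j) (insertion j pi A) = A.
Proof.
move=> tr1; apply/wentryP => x y; rewrite deletion1E.
have insK c z : [ffun k => insert_at j c z (lift j k)] = z.
  by apply/ffunP => k; rewrite !ffunE liftK.
under eq_bigr => c _ do rewrite insertionE !insK !ffunE unlift_none.
by rewrite -mulr_suml -[\sum_i _]/(\tr pi) tr1 mul1r.
Qed.

Definition reorder n (s : 'S_n) (x : word d n) : word d n := [ffun i => x (s i)].

(* Inserting at j2 = lift j1 p and then deleting at j1 = lift j2 q moves the
   q-th qudit to the position p and replaces it. *)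
Lemma insdel_diff n (j1 j2 : 'I_n.+2) (p q : 'I_n.+1) (pi : 'M[C]_d)
    (A : 'M[C]_(qdim d n.+1)) x y :
  j2 = lift j1 p -> j1 = lift j2 q ->
  let s := lift_perm p q 1%g in
  wentry (deletion (card_setC1_ord j1) (insertion j2 pi A)) x y =
  pi (x p) (y p) * \sum_c wentry A (replace_at q c (reorder s^-1 x))
                                   (replace_at q c (reorder s^-1 y)).
Proof.
move=> j2E j1E s; rewrite deletion1E mulr_sumr; apply: eq_bigr => c _.
rewrite insertionE.
have ins2 z : insert_at j1 c z j2 = z p by rewrite ffunE j2E liftK.
rewrite !ins2; suff insE z : [ffun k => insert_at j1 c z (lift j2 k)] =
  replace_at q c (reorder s^-1 z) by rewrite !insE.
apply/ffunP => k; rewrite !ffunE; case: (unliftP q k) => [k' kE|->].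
  (* Both sides skip [j1] and [j2] and count the remaining positions in order. *)
  have -> : lift j2 k = lift j1 (lift p k').
    apply/val_inj; have := congr1 val j1E; have := congr1 val j2E.
    by rewrite kE /= /bump; lia.
  rewrite liftK kE eq_sym (negbTE (neq_lift _ _)).
  by congr (z _); apply: (@perm_inj _ s); rewrite permKV lift_perm_lift perm1.
by rewrite -j1E unlift_none eqxx.
Qed.

End Words.

(** * Deletion of a set containing the relocated qudit *)

Section Relocated.
Variables (C : numClosedFieldType) (d n m : nat).
Variables (s : 'S_n) (p : 'I_n) (S : {set 'I_n}).
Variables (eS : #|~: S| = m) (eJ : #|~: (s @: S)| = m).
Hypothesis pS : p \in S.
Hypothesis s_lt : forall i j : 'I_n, i \notin S -> j \notin S ->
  (i < j)%N -> (s i < s j)%N.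

Lemma kept_relocated k : kept eJ k = s (kept eS k).
Proof.
apply: (@kept_eq _ _ _ eJ (fun k => s (kept eS k))) => {}k => [k' kk'|].
  by apply: s_lt; rewrite ?kept_notin ?kept_lt.
by rewrite (mem_imset _ _ perm_inj) kept_notin.
Qed.

(** Tracing out [S] removes the independent qudit at [p], which contributes only [\tr f]. The kept
    qudits are renamed increasingly by [s], so [s @: S] is deleted from [B]; the sum over [c] traces
    out its qudit [s p]. *)
Lemma deletion_relocated (f : 'M[C]_d) (A B : 'M[C]_(qdim d n)) :
  (forall x y, wentry A x y = f (x p) (y p) *
     \sum_c wentry B (replace_at (s p) c (reorder s^-1 x))
                     (replace_at (s p) c (reorder s^-1 y))) ->
  deletion eS A = \tr f *: deletion eJ B.
Proof.
move=> AE; apply/wentryP => a b.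
have -> : wentry (\tr f *: deletion eJ B) a b =
    \tr f * wentry (deletion eJ B) a b by rewrite /wentry mxE.
rewrite !wmatrixE.
have reK : cancel (@reorder d n s) (reorder s^-1).
  by move=> z; apply/ffunP => i; rewrite !ffunE permKV.
have reKV : cancel (@reorder d n s^-1) (reorder s).
  by move=> z; apply/ffunP => i; rewrite !ffunE permK.
have sub_re (z : word d n) : subword eS (reorder s z) = subword eJ z.
  by apply/ffunP => k; rewrite !ffunE kept_relocated.
(* The pairs of words that enter the [(a, b)] entry of [deletion eJ B]. *)
pose P (z w : word d n) := [&& subword eJ z == a, subword eJ w == b &
               [forall i in s @: S, z i == w i]].
have eq_on (z w : word d n) : [forall i in S, reorder s z i == reorder s w i] =
                 [forall i in s @: S, z i == w i].
  apply/forall_inP/forall_inP => zw i.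
    by case/imsetP => j jS ->; have := zw j jS; rewrite !ffunE.
  by move=> iS; rewrite !ffunE; apply: zw; rewrite imset_f.
have qJ : s p \in s @: S by rewrite imset_f.
have repl_at c (z : word d n) : replace_at (s p) c z (s p) = c by rewrite ffunE eqxx.
have replK c (z : word d n) : replace_at (s p) (z (s p)) (replace_at (s p) c z) = z.
  by apply/ffunP => i; rewrite !ffunE; case: eqP => [->|].
have sub_repl c (z : word d n) : subword eJ (replace_at (s p) c z) = subword eJ z.
  apply/ffunP => k; rewrite !ffunE; case: eqP => // kq.
  by have := kept_notin eJ k; rewrite kq qJ.
have P_repl (z w : word d n) c : P (replace_at (s p) c z) (replace_at (s p) c w) &&
    (z (s p) == w (s p)) = P z w.
  rewrite /P !sub_repl; case: (_ == a) => //; case: (_ == b) => //=.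
  apply/andP/forall_inP => [[/forall_inP zw /eqP zwq] i iJ|zw].
    by have := zw i iJ; rewrite !ffunE; case: (i =P s p) => [->|//]; rewrite zwq.
  split; last exact: zw.
  by apply/forall_inP => i iJ; rewrite !ffunE; case: (i =P s p) => // _; apply: zw.
(* Exchanges the common letter of the two words at [s p] with the summation letter. On [P] this is
   an involution, which separates the factor [f] from the sum over [B]. *)
pose swap (u : word d n * word d n * 'I_d) :=
  (replace_at (s p) u.2 u.1.1, replace_at (s p) u.2 u.1.2, u.1.1 (s p)).
have swapK u : P u.1.1 u.1.2 -> swap (swap u) = u.
  case: u => [[z w] c] /= /and3P[_ _ /forall_inP /(_ _ qJ) /eqP zw].
  by rewrite /swap /= repl_at replK zw replK.
transitivity (\sum_(u : word d n * word d n * 'I_d | P u.1.1 u.1.2)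
   f (u.1.1 (s p)) (u.1.1 (s p)) *
   wentry B (replace_at (s p) u.2 u.1.1) (replace_at (s p) u.2 u.1.2)).
  rewrite (reindex (@reorder d n s)) /=; last exact: onW_bij (Bijective reK reKV).
  transitivity (\sum_(z | subword eJ z == a)
    \sum_(w | (subword eJ w == b) && [forall i in s @: S, z i == w i])
    \sum_c f (z (s p)) (z (s p)) *
           wentry B (replace_at (s p) c z) (replace_at (s p) c w)).
    apply: eq_big => [z|z _]; first by rewrite sub_re.
    rewrite (reindex (@reorder d n s)) /=; last exact: onW_bij (Bijective reK reKV).
    apply: eq_big => [w|w]; first by rewrite sub_re eq_on.
    rewrite eq_on => /andP[_ /forall_inP /(_ _ qJ) /eqP zw].
    by rewrite AE !reK !ffunE zw mulr_sumr.
  rewrite pair_big_dep pair_big_dep /=.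
  by apply: eq_bigl => u; rewrite andbT.
rewrite (reindex_onto swap swap) /=; last by move=> u; apply: swapK.
transitivity (\sum_(u : word d n * word d n * 'I_d | P u.1.1 u.1.2)
   f u.2 u.2 * wentry B u.1.1 u.1.2).
  have PE u : P (swap u).1.1 (swap u).1.2 && (swap (swap u) == u) = P u.1.1 u.1.2.
    apply/andP/idP => [[Pu /eqP uE]|Pu]; last first.
      rewrite swapK // eqxx; split=> //.
      by move: Pu; rewrite -(P_repl _ _ u.2) => /andP[].
    rewrite -(P_repl _ _ u.2) Pu /=.
    by case: u uE {Pu} => [[z w] c] [_ <- _] /=; rewrite repl_at.
  apply: eq_big => [u|u]; first exact: PE.
  by rewrite PE => /swapK uE; rewrite -[in RHS]uE /= !repl_at.
rewrite pair_big_dep /= [RHS]mulrC big_distrlr /= pair_big /=.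
by apply: eq_big => [u|u _]; rewrite ?andbT // mulrC.
Qed.
End Relocated.

(** * Levels and measurement *)

Section Levels.
Variables (C : numClosedFieldType) (l t n : nat).
Implicit Types (r : n.-tuple 'I_t.+1) (x y : word (l * t.+1) n) (a b : word l n).

Definition has_levels r x : bool := [forall i, x i %% t.+1 == tnth r i]%N.

Lemma level_mod (j : 'I_l) (k : 'I_t.+1) : (level j k %% t.+1)%N = k.
Proof. by rewrite /= modnMDl modn_small. Qed.

Lemma level_div_proof (c : 'I_(l * t.+1)) : (c %/ t.+1 < l)%N.
Proof. by rewrite ltn_divLR. Qed.

Lemma level_inj (k : 'I_t.+1) : injective (fun j : 'I_l => level j k).
Proof.
move=> j j' /(congr1 val) /eqP /=.
by rewrite eqn_add2r eqn_pmul2r // => /eqP /val_inj.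
Qed.

Lemma level_div (c : 'I_(l * t.+1)) (k : 'I_t.+1) :
  (c %% t.+1)%N = k -> level (Ordinal (level_div_proof c)) k = c.
Proof. by move=> e; apply/val_inj; rewrite /= -e -divn_eq. Qed.

Lemma measE (k : 'I_t.+1) (c c' : 'I_(l * t.+1)) :
  meas C l k c c' = ((c == c') && (c %% t.+1 == k)%N)%:R.
Proof.
rewrite /meas summxE; under eq_bigr => j _ do rewrite mxE.
case: eqP => [<-|ne] /=; last first.
  rewrite big1 // => j _; case: eqP => [cE|//]; case: eqP => [c'E|//].
  by case: ne; rewrite cE c'E.
case: eqP => [e|ne].
  rewrite (bigD1 (Ordinal (level_div_proof c))) //= level_div // eqxx big1 ?addr0 //.
  move=> j jN; rewrite andbb -{1}(level_div e) (inj_eq (@level_inj k)) eq_sym.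
  by rewrite (negbTE jN).
rewrite big1 // => j _; case: eqP => // cE; case: ne.
by rewrite cE level_mod.
Qed.

Lemma prod_nat_bool (I : finType) (P : pred I) :
  \prod_i (P i)%:R = [forall i, P i]%:R :> C.
Proof.
case: forallP => [allP|nall].
  by apply: big1 => i _; rewrite allP.
have /existsP [i Pi] : [exists i, ~~ P i].
  by rewrite -negb_forall; apply/negP => /forallP.
by rewrite (bigD1 i) //= (negbTE Pi) mul0r.
Qed.

Lemma meas_wordE r x y :
  wentry (meas_word C l r) x y = ((x == y) && has_levels r x)%:R.
Proof.
rewrite wmatrixE; under eq_bigr => i _ do rewrite measE.
rewrite prod_nat_bool; congr (nat_of_bool _)%:R.
apply/forallP/andP => [xy|[/eqP <- /forallP xr] i]; last by rewrite eqxx xr.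
split; last by apply/forallP => i; have /andP[] := xy i.
by apply/eqP/ffunP => i; have /andP[/eqP] := xy i.
Qed.

Lemma outcome_probE (rho : 'M[C]_(qdim (l * t.+1) n)) r :
  outcome_prob rho r = \sum_(x | has_levels r x) wentry rho x x.
Proof.
rewrite /outcome_prob trace_words [RHS]big_mkcond; apply: eq_bigr => x _.
rewrite wentry_mul (bigD1 x) //= meas_wordE eqxx big1 ?addr0 => [|y yx].
  by case: has_levels; rewrite ?mul1r ?mul0r.
by rewrite meas_wordE eq_sym (negbTE yx) mul0r.
Qed.

Lemma post_stateE (rho : 'M[C]_(qdim (l * t.+1) n)) r x y :
  wentry (post_state rho r) x y = (outcome_prob rho r)^-1 *
    ((has_levels r x && has_levels r y)%:R * wentry rho x y).
Proof.
rewrite {1}/wentry mxE -/(wentry _ x y); congr (_ * _).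
rewrite wentry_mul (bigD1 y) //= wentry_adj meas_wordE eqxx /=.
rewrite big1 ?addr0 => [|z zy]; last first.
  by rewrite wentry_adj meas_wordE eq_sym (negbTE zy) rmorph0 mulr0.
rewrite wentry_mul (bigD1 x) //= meas_wordE eqxx big1 ?addr0 => [|z zx]; last first.
  by rewrite meas_wordE eq_sym (negbTE zx) mul0r.
by rewrite rmorph_nat; do 2!case: has_levels;
  rewrite /= ?(mul0r, mulr0, mul1r, mulr1).
Qed.

Lemma trace_post_state (rho : 'M[C]_(qdim (l * t.+1) n)) r :
  outcome_prob rho r != 0 -> \tr (post_state rho r) = 1.
Proof.
move=> p0; rewrite trace_words -(mulVf p0) {2}outcome_probE mulr_sumr.
rewrite [RHS]big_mkcond; apply: eq_bigr => x _; rewrite post_stateE andbb.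
by case: has_levels; rewrite ?mul1r ?mul0r ?mulr0.
Qed.

Definition lift_word a : word (l * t.+1) n :=
  [ffun i => level (a i) (tnth (mod_seq t n) i)].

Lemma lift_word_levels a : has_levels (mod_seq t n) (lift_word a).
Proof. by apply/forallP => i; rewrite ffunE level_mod. Qed.

Lemma lift_word_inj : injective lift_word.
Proof.
move=> a b /ffunP ab; apply/ffunP => i.
by have := ab i; rewrite !ffunE => /level_inj.
Qed.

Definition unlift_word x : word l n :=
  [ffun i => Ordinal (level_div_proof (x i))].

Lemma unlift_wordK x : has_levels (mod_seq t n) x ->
  lift_word (unlift_word x) = x.
Proof.
by move=> /forallP xm; apply/ffunP => i; rewrite !ffunE level_div //; exact/eqP.
Qed.

Lemma sum_lift_word (F : word (l * t.+1) n -> C) :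
  \sum_(x | has_levels (mod_seq t n) x) F x = \sum_a F (lift_word a).
Proof.
rewrite (reindex_onto lift_word unlift_word) => [|x]; last exact: unlift_wordK.
apply: eq_bigl => a; rewrite lift_word_levels; apply/eqP/lift_word_inj.
by rewrite unlift_wordK ?lift_word_levels.
Qed.

Lemma eta_allE x a : wentry (eta_all C l t n) x a = (x == lift_word a)%:R.
Proof.
rewrite wmatrixE; under eq_bigr => i _ do rewrite mxE.
rewrite prod_nat_bool; congr (nat_of_bool _)%:R.
apply/forallP/eqP => [xa|-> i]; last by rewrite ffunE.
by apply/ffunP => i; rewrite ffunE; apply/eqP.
Qed.

Lemma unlift_state (A : 'M[C]_(qdim (l * t.+1) n)) a b :
  wentry ((eta_all C l t n)^t* *m A *m eta_all C l t n) a b =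
  wentry A (lift_word a) (lift_word b).
Proof.
rewrite wentry_mul (bigD1 (lift_word b)) //= eta_allE eqxx mulr1.
rewrite big1 ?addr0 => [|z zb]; last by rewrite eta_allE (negbTE zb) mulr0.
rewrite wentry_mul (bigD1 (lift_word a)) //= wentry_adj eta_allE eqxx rmorph1 mul1r.
by rewrite big1 ?addr0 // => z za; rewrite wentry_adj eta_allE (negbTE za) rmorph0 mul0r.
Qed.

Variables (u : nat) (V : 'M[C]_(qdim l n, qdim l u)) (mu : 'cV[C]_(qdim l u)).

Lemma amplitude_MH x : amplitude (MH_codeword t V mu) x =
  \sum_a (x == lift_word a)%:R * amplitude (V *m mu) a.
Proof.
rewrite /amplitude mxE sum_words; apply: eq_bigr => a _.
by rewrite -eta_allE.
Qed.

Lemma amplitude_MH_lift a :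
  amplitude (MH_codeword t V mu) (lift_word a) = amplitude (V *m mu) a.
Proof.
rewrite amplitude_MH (bigD1 a) //= eqxx mul1r big1 ?addr0 // => b ba.
by rewrite (inj_eq lift_word_inj) eq_sym (negbTE ba) mul0r.
Qed.

Lemma amplitude_MH_levels x : amplitude (MH_codeword t V mu) x != 0 ->
  has_levels (mod_seq t n) x.
Proof.
apply: contraNT => nx; rewrite amplitude_MH big1 // => a _.
by case: eqP => [xE|]; rewrite ?mul0r //; case/negP: nx; rewrite xE lift_word_levels.
Qed.

Lemma trace_pure_MH : Defs.isometry V -> unit_vector mu ->
  \tr (pure (MH_codeword t V mu)) = 1.
Proof.
move=> iV umu; rewrite /pure mxtrace_mulC.
have -> : (MH_codeword t V mu)^t* *m MH_codeword t V mu = (V *m mu)^t* *m (V *m mu).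
  rewrite /MH_codeword trmx_mul map_mxM /= mulmxA -(mulmxA _ _ (eta_all C l t n)).
  suff -> : (eta_all C l t n)^t* *m eta_all C l t n = 1%:M by rewrite mulmx1.
  apply/wentryP => a b; have := unlift_state 1%:M a b; rewrite mulmx1 => ->.
  by rewrite /wentry !mxE !(inj_eq enum_rank_inj) (inj_eq lift_word_inj).
rewrite trmx_mul map_mxM /= mulmxA -(mulmxA _ _ V) iV mulmx1 umu.
exact: mxtrace1.
Qed.

End Levels.

(** * Correction of single-qudit errors *)

Section QuantumOperations.
Variable C : numClosedFieldType.

Lemma adj_mul m n p (A : 'M[C]_(m, n)) (B : 'M[C]_(n, p)) :
  (A *m B)^t* = B^t* *m A^t*.
Proof. by rewrite trmx_mul map_mxM. Qed.

Lemma adjK m n (A : 'M[C]_(m, n)) : A^t*^t* = A.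
Proof. by apply/matrixP => i j; rewrite !mxE conjCK. Qed.

Lemma trace_quantum_operation N N' (Phi : 'M[C]_N -> 'M[C]_N') A :
  quantum_operation Phi -> \tr (Phi A) = \tr A.
Proof.
move=> [k [K [K1 ->]]]; rewrite -[in RHS](mul1mx A) -K1 mulmx_suml !raddf_sum /=.
by apply: eq_bigr => i _; rewrite mxtrace_mulC mulmxA.
Qed.

Lemma trace_pure N (v : 'cV[C]_N) : \tr (pure v) = \sum_a `|v a 0| ^+ 2.
Proof.
by apply: eq_bigr => a _; rewrite !mxE big_ord1 !mxE normCK.
Qed.

Lemma trace_pure_unit N (v : 'cV[C]_N) : unit_vector v -> \tr (pure v) = 1.
Proof. by move=> uv; rewrite /pure mxtrace_mulC uv mxtrace1. Qed.

(** The projection away from [mu] annihilates the sum. The projected summands have nonnegative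
    traces adding up to 0, so each one vanishes. *)
Lemma pure_sum_supp N k (w : 'I_k -> 'cV[C]_N) (mu : 'cV[C]_N) :
  unit_vector mu -> \sum_i pure (w i) = pure mu ->
  forall i, (1%:M - pure mu) *m w i = 0.
Proof.
move=> umu wE; set P := 1%:M - pure mu.
have Pmu : P *m pure mu = 0.
  by rewrite mulmxBl mul1mx /pure mulmxA -(mulmxA mu) umu mulmx1 subrr.
have : \sum_i \tr (pure (P *m w i)) = 0.
  have -> : \sum_i \tr (pure (P *m w i)) = \tr (P *m (\sum_i pure (w i)) *m P^t*).
    rewrite mulmx_sumr mulmx_suml raddf_sum; apply: eq_bigr => i _.
    by rewrite /pure adj_mul !mulmxA.
  by rewrite wE Pmu mul0mx mxtrace0.
have ge0 (v : 'cV[C]_N) : 0 <= \tr (pure v).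
  by rewrite trace_pure sumr_ge0 // => a _; rewrite exprn_ge0.
move=> /psumr_eq0P => /(_ (fun i _ => ge0 _)) tr0 i.
have := tr0 i isT; rewrite trace_pure => /psumr_eq0P => v0.
apply/matrixP => a b; rewrite (ord1 b) [RHS]mxE; apply/eqP.
by rewrite -normr_eq0 -sqrf_eq0 v0 // => c _; rewrite exprn_ge0.
Qed.

Lemma delta_mx_unitary l (a b : 'I_l) : exists U W : 'M[C]_l,
  [/\ U \is unitarymx, W \is unitarymx & delta_mx a b = 2^-1 *: (U - W)].
Proof.
(* [U] exchanges [a] and [b], and [Z] flips the sign of row [a]; so [U] and [Z *m U] differ exactly
   in row [a], where [U] has its 1 in column [b]. *)
pose U : 'M[C]_l := perm_mx (tperm a b); pose Z : 'M[C]_l := 1%:M - 2 *: delta_mx a a.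
have Uu : U \is unitarymx.
  apply/unitarymxP; rewrite tr_perm_mx map_perm_mx -perm_mxM mulgV perm_mx1 //.
have Zu : Z \is unitarymx.
  have Zadj : Z^t* = Z.
    rewrite /Z linearB /= tr_scalar_mx linearZ /= trmx_delta map_mxB map_mxZ.
    by rewrite map_mx1 map_delta_mx rmorph_nat.
  apply/unitarymxP; rewrite Zadj /Z mulmxBl mul1mx mulmxBr mulmx1.
  rewrite -scalemxAl -scalemxAr mul_delta_mx scalerA.
  apply/matrixP => i j; rewrite !mxE; ring.
exists U, (Z *m U); split=> //; first exact: mul_unitarymx.
rewrite mulmxBl mul1mx opprB addrCA subrr addr0 -scalemxAl scalerA.
rewrite mulVf ?pnatr_eq0 // scale1r.
apply/matrixP => i j; rewrite [RHS]mxE (bigD1 a) //= big1 => [|k ka].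
  rewrite !mxE eqxx andbT tpermL addr0 -natrM mulnb.
  by rewrite (eq_sym j).
by rewrite !mxE (negbTE ka) andbF mul0r.
Qed.

Variables (l n : nat).

Definition local_op (q : 'I_n) (E : 'M[C]_l) : 'M[C]_(qdim l n) :=
  tensor (fun i => if i == q then E else 1%:M).

Lemma amplitude_local q E v a : amplitude (local_op q E *m v) a =
  \sum_c E (a q) c * amplitude v (replace_at q c a).
Proof.
rewrite /amplitude mxE sum_words.
have locE b : local_op q E (enum_rank a) (enum_rank b) =
    E (a q) (b q) * [forall i, (i != q) ==> (a i == b i)]%:R.
  rewrite [LHS]wmatrixE (bigD1 q) //= eqxx; congr (_ * _).
  rewrite -prod_nat_bool [LHS]big_mkcond; apply: eq_bigr => i _.
  by case: ifP => //= /negbTE ->; rewrite mxE.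
transitivity (\sum_(b : word l n | [forall i, (i != q) ==> (a i == b i)])
    E (a q) (b q) * v (enum_rank b) 0).
  rewrite [RHS]big_mkcond; apply: eq_bigr => b _; rewrite locE.
  by case: ifP; rewrite ?mulr1 // mulr0 mul0r.
rewrite (reindex_onto (fun c => replace_at q c a)
  (fun b : word l n => b q)) /=; last first.
  move=> b /forallP ab; apply/ffunP => i; rewrite ffunE; case: eqP => [->//|/eqP iq].
  by have := ab i; rewrite iq => /eqP.
apply: eq_big => c; last by rewrite ffunE eqxx.
rewrite ffunE !eqxx andbT; apply/forallP => i; rewrite ffunE.
by apply/implyP => /negbTE ->.
Qed.

Lemma local_op1 q : local_op q 1%:M = 1%:M.
Proof.
apply/wentryP => a b; rewrite wmatrixE.
under eq_bigr => i _ do rewrite if_same mxE.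
rewrite prod_nat_bool /wentry mxE (inj_eq enum_rank_inj).
congr (nat_of_bool _)%:R; apply/forallP/eqP => [ab|-> i]; last exact: eqxx.
by apply/ffunP => i; apply/eqP.
Qed.

Lemma amplitude_local_delta q a c v x :
  amplitude (local_op q (delta_mx a c) *m v) x =
  (x q == a)%:R * amplitude v (replace_at q c x).
Proof.
rewrite amplitude_local (bigD1 c) //= big1 ?addr0 => [|b bc].
  by rewrite mxE eqxx andbT.
by rewrite mxE (negbTE bc) andbF mul0r.
Qed.

Lemma amplitudeP (v w : 'cV[C]_(qdim l n)) : amplitude v =1 amplitude w -> v = w.
Proof.
move=> vw; apply/matrixP => a b; rewrite (ord1 b).
by have := vw (enum_val a); rewrite /amplitude !enum_valK.
Qed.

Variables (u : nat) (V : 'M[C]_(qdim l n, qdim l u)).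
Variable Uni : 'M[C]_(qdim l n) -> 'M[C]_(qdim l u).
Hypothesis hUni : unitary_decoder V Uni.
Variable mu : 'cV[C]_(qdim l u).
Hypothesis umu : unit_vector mu.

(* A quantum operation which corrects the unitary errors on a qudit corrects
   all the errors on it, since these are spanned by unitary ones. *)
Lemma unitary_decoder_replaced (q : 'I_n) (g : 'M[C]_l) (tau : 'M[C]_(qdim l n)) :
  \tr tau = 1 ->
  (forall a b, wentry tau a b = g (a q) (b q) *
     \sum_c wentry (pure (V *m mu)) (replace_at q c a) (replace_at q c b)) ->
  Uni tau = pure mu.
Proof.
move=> tr1 tauE; have [qU corrU] := hUni.
have [k [K [_ UniE]]] := qU.
set P := 1%:M - pure mu.
(* As [U] is corrected, the [K i] send the damaged codeword to vectors whose rank-one matrices sum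
   to [pure mu]; each is thus a multiple of [mu]. *)
have supp_U U i : U \is unitarymx -> P *m (K i *m (local_op q U *m (V *m mu))) = 0.
  move=> uU.
  apply: (pure_sum_supp
    (w := fun i => K i *m (local_op q U *m (V *m mu)))) => //.
  rewrite -(corrU mu umu q U uU) UniE; apply: eq_bigr => j _.
  by rewrite /pure (adj_mul (K j)) !mulmxA.
have supp_delta a c i : P *m (K i *m (local_op q (delta_mx a c) *m (V *m mu))) = 0.
  have [U [W [uU uW dE]]] := delta_mx_unitary a c.
  have -> : local_op q (delta_mx a c) *m (V *m mu) = 2^-1 *:
      (local_op q U *m (V *m mu) - local_op q W *m (V *m mu)).
    apply: amplitudeP => x; rewrite amplitude_local /amplitude [RHS]mxE.
    rewrite [in RHS]mxE [X in _ = _ * (_ + X)]mxE -!/(amplitude _ _).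
    rewrite !amplitude_local -sumrB mulr_sumr; apply: eq_bigr => b _.
    rewrite -/(amplitude (V *m mu) (replace_at q b x)); move: (amplitude _ _) => z.
    by rewrite dE !mxE -mulrA mulrBl.
  by rewrite -!scalemxAr !mulmxBr !supp_U // subrr scaler0.
have supp_tau i (f : 'M[C]_l) (A : 'M[C]_(qdim l n)) :
    (forall a b, wentry A a b = f (a q) (b q) *
     \sum_c wentry (pure (V *m mu)) (replace_at q c a) (replace_at q c b)) ->
    P *m (K i *m A) = 0.
  move=> AE.
  (* Every column of [A] is a combination of matrix-unit errors at [q] applied to the codeword. *)
  have -> : A = \sum_c \sum_a local_op q (delta_mx a c) *m (V *m mu) *m
      (\row_b (f a ((enum_val b : word l n) q) *
        (amplitude (V *m mu) (replace_at q c (enum_val b)))^*)).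
    apply/wentryP => x y; rewrite AE mulr_sumr [in RHS]/wentry summxE.
    apply: eq_bigr => c _; rewrite wentry_pure summxE (bigD1 (x q)) //=.
    rewrite big1 ?addr0 => [|a ax].
      rewrite [RHS]mxE big_ord1 -/(amplitude (local_op _ _ *m _) x).
      by rewrite amplitude_local_delta eqxx mul1r mxE enum_rankK mulrCA.
    rewrite mxE big_ord1 -/(amplitude (local_op _ _ *m _) x).
    by rewrite amplitude_local_delta eq_sym (negbTE ax) !mul0r.
  rewrite !mulmx_sumr big1 // => c _; rewrite !mulmx_sumr big1 // => a _.
  by rewrite (mulmxA (K i)) mulmxA supp_delta mul0mx.
have Ptau i : K i *m tau = pure mu *m (K i *m tau).
  have := supp_tau i g tau tauE; rewrite mulmxBl mul1mx => /eqP.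
  by rewrite subr_eq0 => /eqP.
(* The adjoint of [tau] has the same form with [g^t*], so [pure mu] can be inserted on the right as
   well. *)
have Ptau' i : tau *m (K i)^t* = tau *m (K i)^t* *m pure mu.
  have tauE' a b : wentry (tau^t*) a b = (g^t*) (a q) (b q) *
     \sum_c wentry (pure (V *m mu)) (replace_at q c a) (replace_at q c b).
    rewrite wentry_adj tauE rmorphM /= rmorph_sum /= !mxE; congr (_ * _).
    by apply: eq_bigr => c _; rewrite !wentry_pure rmorphM /= conjCK mulrC.
  have := supp_tau i _ _ tauE'; rewrite mulmxBl mul1mx => /eqP.
  rewrite subr_eq0 => /eqP /(congr1 (fun A : 'M_(_, _) => A^t*)).
  by rewrite !adj_mul !adjK.
(* Projected on both sides, the output is a multiple of [pure mu]; its trace is the factor. *)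
have UniP : Uni tau = \tr (Uni tau) *: pure mu.
  have -> : Uni tau = (\sum_i (mu^t* *m (K i *m tau *m (K i)^t*) *m mu) 0 0) *: pure mu.
    rewrite UniE scaler_suml; apply: eq_bigr => i _.
    rewrite [in LHS]Ptau -(mulmxA (pure mu)) -(mulmxA (K i)) [in LHS]Ptau'.
    set M := _ *m mu; rewrite /pure scalemxAl -mul_mx_scalar -mx11_scalar.
    by rewrite /M !mulmxA.
  by rewrite mxtraceZ (trace_pure_unit umu) mulr1.
by rewrite UniP trace_quantum_operation // tr1 scale1r.
Qed.

End QuantumOperations.

(** * The decoder *)

Lemma nth_mod_seq t n i : (i < n)%N -> nth ord0 (mod_seq t n) i = inord (i %% t.+1).
Proof.
by move=> ilt; rewrite -(tnth_nth ord0 (mod_seq t n) (Ordinal ilt)) tnth_mktuple.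
Qed.

(** [t.+1] divides no positive difference up to [t]. *)
Lemma mod_seq_neq t n i j : (i < j)%N -> (j < n)%N -> (j - i <= t)%N ->
  nth ord0 (mod_seq t n) i <> nth ord0 (mod_seq t n) j.
Proof.
move=> ij jn jit; have ilt := ltn_trans ij jn.
rewrite !nth_mod_seq // => /(congr1 (@nat_of_ord _)).
rewrite !inordK ?ltn_pmod // => /eqP.
rewrite eq_sym eqn_mod_dvd ?(ltnW ij) // => /dvdn_leq; lia.
Qed.

(** Equality after the removal of one letter is unfolded into equalities before, between and after
    [p] and [q], where [bump] gives the shift by one. *)
Lemma relocation_subroutines t n (r : n.+1.-tuple 'I_t.+1) (p q : 'I_n.+1) :
  let m := mod_seq t n.+1 in let h := indel m r in
  (2 <= t)%N -> (forall k, tnth r (lift p k) = tnth m (lift q k)) ->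
  (r = m -> p = q) /\
  (r <> m -> p \in subroutine1 m r h :|: subroutine2 m r h /\
             (#|subroutine1 m r h :|: subroutine2 m r h| <= 2)%N).
Proof.
move=> m h ht rm.
have rmn k : (k < n)%N -> nth ord0 r (bump p k) = nth ord0 m (bump q k).
  by move=> kn; have := rm (Ordinal kn); rewrite !(tnth_nth ord0).
have m1 i : (i.+1 < n.+1)%N -> nth ord0 m i <> nth ord0 m i.+1.
  by move=> ?; apply: mod_seq_neq; lia.
have m2 i : (i.+2 < n.+1)%N -> nth ord0 m i <> nth ord0 m i.+2.
  by move=> ?; apply: mod_seq_neq; lia.
have [pn qn] := (ltn_ord p, ltn_ord q).
have mr i : (i < n.+1)%N -> (i < minn p q \/ maxn p q < i)%N ->
    nth ord0 m i = nth ord0 r i.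
  move=> ilt [] iE.
    have := rmn i; rewrite /bump.
    have [-> ->] : (p <= i)%N = false /\ (q <= i)%N = false by lia.
    by rewrite add0n => -> //; lia.
  have := rmn i.-1; rewrite /bump.
  have [-> ->] : (p <= i.-1)%N /\ (q <= i.-1)%N by lia.
  by rewrite add1n prednK => [-> //|]; lia.
have mrl i : (p <= i < q)%N -> nth ord0 m i = nth ord0 r i.+1.
  move=> piq; have := rmn i; rewrite /bump.
  have [-> ->] : (p <= i)%N /\ (q <= i)%N = false by lia.
  by rewrite add0n add1n => -> //; lia.
have mrr i : (q <= i < p)%N -> nth ord0 m i.+1 = nth ord0 r i.
  move=> qip; have := rmn i; rewrite /bump.
  have [-> ->] : (q <= i)%N /\ (p <= i)%N = false by lia.
  by rewrite add0n add1n => -> //; lia.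
split=> [rE|rNm].
  (* With [p <> q], the shifted stretch would make two neighbouring letters of [m] equal. *)
  case: (ltngtP p q) => [pq|qp|/val_inj//].
    by case: (m1 p); [lia | rewrite mrl ?rE //; lia].
  by case: (m1 q); [lia | rewrite mrr -?rE //; lia].
have mNr : m <> r by move=> e; apply: rNm.
split; first exact: (@mem_subroutines _ _ m r p q).
exact: (@card_subroutines _ _ m r p q).
Qed.

Lemma lift_perm1_lt n (p q i j : 'I_n.+1) : i != p -> j != p -> (i < j)%N ->
  (lift_perm p q 1%g i < lift_perm p q 1%g j)%N.
Proof.
case: (unliftP p i) => [i' ->|->]; last by rewrite eqxx.
case: (unliftP p j) => [j' ->|->] _; last by rewrite eqxx.
by rewrite !lift_perm_lift !perm1 /= /bump; lia.
Qed.

Lemma sum_level (C : numClosedFieldType) l t (k : 'I_t.+1) (F : 'I_(l * t.+1) -> C) :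
  (forall c : 'I_(l * t.+1), (c %% t.+1 != k)%N -> F c = 0) ->
  \sum_c F c = \sum_(j < l) F (level j k).
Proof.
move=> F0; rewrite (bigID (fun c : 'I_(l * t.+1) => c %% t.+1 == k)%N) /=.
rewrite [X in _ + X]big1 ?addr0 //.
rewrite (reindex_onto (fun j : 'I_l => level j k)
  (fun c => Ordinal (level_div_proof c))) => [|c /eqP]; last exact: level_div.
apply: eq_bigl => j; rewrite level_mod eqxx; apply/eqP/(@level_inj _ _ k).
by rewrite level_div // level_mod.
Qed.

Section Decoder.
Variables (C : numClosedFieldType) (t n l u : nat).
Hypothesis ht : (2 <= t)%N.
Variable V : 'M[C]_(qdim l n.+1, qdim l u).
Hypothesis iV : Defs.isometry V.
Variable Del : forall m, 'M[C]_(qdim (l * t.+1) m) -> 'M[C]_(qdim l u).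
Hypothesis hDel : deletion_decoder V Del.
Variable Uni : 'M[C]_(qdim l n.+1) -> 'M[C]_(qdim l u).
Hypothesis hUni : unitary_decoder V Uni.
Variables (mu : 'cV[C]_(qdim l u)) (umu : unit_vector mu).
Local Notation psi := (MH_codeword t V mu).
Local Notation m := (mod_seq t n.+1).

(** The equation [e] allows the received state to be typed by the complement of another set of the
    same size. *)
Lemma deletion_decoderE k (J : {set 'I_n.+1}) (e : #|~: J| = k) :
  (#|J| <= t)%N -> Del (deletion e (pure psi)) = pure mu.
Proof. by case: k / e => Jt; apply: hDel. Qed.

Lemma post_state_levels (rho : 'M[C]_(qdim (l * t.+1) n.+1)) r :
  outcome_prob rho r != 0 ->
  exists2 x, has_levels r x & wentry rho x x != 0.
Proof.
rewrite outcome_probE; case: (altP (@existsP _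
  (fun x => has_levels r x && (wentry rho x x != 0)))).
  by move=> [x /andP[xr x0]] _; exists x.
move=> /existsPn none; rewrite big1 ?eqxx // => x xr.
by have := none x; rewrite xr negbK => /eqP.
Qed.

Lemma trace_unlift_post_state (rho : 'M[C]_(qdim (l * t.+1) n.+1)) :
  outcome_prob rho m != 0 ->
  \tr ((eta_all C l t n.+1)^t* *m post_state rho m *m eta_all C l t n.+1) = 1.
Proof.
move=> p0; rewrite -(trace_post_state p0) !trace_words.
rewrite (bigID (has_levels m)) /= [X in _ = _ + X]big1 ?addr0; last first.
  by move=> x /negbTE nx; rewrite post_stateE nx mul0r mulr0.
by rewrite sum_lift_word; apply: eq_bigr => a _; rewrite unlift_state.
Qed.

(** The codeword is supported on words of levels [m], so the result is [m] with probability 1 and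
    the measurement leaves the state unchanged. *)
Lemma decode_codeword r : outcome_prob (pure psi) r != 0 ->
  decode Del Uni (pure psi) r = pure mu.
Proof.
move=> p0; have [x xr] := post_state_levels p0.
rewrite wentry_pure mulf_eq0 negb_or => /andP[/amplitude_MH_levels xm _].
have rm : r = m.
  apply/eq_from_tnth => i; apply/ord_inj; move/forallP/(_ i)/eqP: xr => <-.
  by move/forallP/(_ i)/eqP: xm => <-.
rewrite rm in p0 *; rewrite /decode eqxx.
have u1 : 1%:M \is @unitarymx C l l.
  by apply/unitarymxP; rewrite trmx1 map_mx1 mulmx1.
rewrite -(hUni.2 mu umu ord0 1%:M u1); congr Uni.
rewrite -/(local_op _ _) local_op1 mul1mx.
apply/wentryP => a b; rewrite unlift_state post_stateE !lift_word_levels mul1r.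
rewrite !wentry_pure !amplitude_MH_lift.
suff -> : outcome_prob (pure psi) m = 1 by rewrite invr1 mul1r.
rewrite -(trace_pure_MH t iV umu) trace_words outcome_probE.
rewrite [RHS](bigID (has_levels m)) /= [X in _ = _ + X]big1 ?addr0 // => y ny.
rewrite wentry_pure; suff -> : amplitude psi y = 0 by rewrite mul0r.
by apply/eqP; apply: contraNT ny; apply: amplitude_MH_levels.
Qed.

Lemma decode_relocated (p q : 'I_n.+1) (pi : 'M[C]_(l * t.+1))
    (rho : 'M[C]_(qdim (l * t.+1) n.+1)) r (s := lift_perm p q 1%g) :
  (forall x y, wentry rho x y = pi (x p) (y p) *
     \sum_c wentry (pure psi) (replace_at q c (reorder s^-1 x))
                              (replace_at q c (reorder s^-1 y))) ->
  outcome_prob rho r != 0 -> decode Del Uni rho r = pure mu.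
Proof.
move=> rhoE p0.
(* Away from [p], the words that carry weight in [rho] have the levels of [m] moved along [s]. *)
have levels c x i : i != p ->
    amplitude psi (replace_at q c (reorder s^-1 x)) != 0 ->
    (x i %% t.+1)%N = tnth m (s i).
  move=> ip /amplitude_MH_levels /forallP /(_ (s i)) /eqP <-.
  rewrite !ffunE permK; case: eqP => // siq; case/eqP: ip.
  by apply: (@perm_inj _ s); rewrite siq lift_perm_id.
have rm k : tnth r (lift p k) = tnth m (lift q k).
  have [x /forallP /(_ (lift p k)) /eqP xr] := post_state_levels p0.
  rewrite rhoE mulf_eq0 negb_or => /andP[_].
  case: (altP (@existsP _
    (fun c => amplitude psi (replace_at q c (reorder s^-1 x)) != 0))).
    move=> [c c0] _; apply/ord_inj; rewrite -xr.
    by rewrite (levels c) ?lift_perm_lift ?perm1 // eq_sym neq_lift.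
  move=> /existsPn none; rewrite big1 ?eqxx // => c _; rewrite wentry_pure.
  by have := none c; rewrite negbK => /eqP ->; rewrite mul0r.
have [rp rn] := relocation_subroutines ht rm.
rewrite /decode; case: eqP => [rE|/rn [pS cardS]].
  have pq := rp rE; have s1 : s = 1%g by rewrite /s pq lift_perm1.
  rewrite rE in p0 *.
  (* The independent qudit compressed to the level that [m] prescribes at [q], divided by the
     probability of the outcome. *)
  pose g : 'M[C]_l := \matrix_(a, b) ((outcome_prob rho m)^-1 *
    pi (level a (tnth m q)) (level b (tnth m q))).
  apply: (unitary_decoder_replaced hUni umu (q := q) (g := g)).
    exact: trace_unlift_post_state.
  move=> a b; rewrite unlift_state post_stateE !lift_word_levels mul1r rhoE.
  rewrite mxE -mulrA pq !ffunE; congr (_ * (_ * _)).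
  have s1E (x : word (l * t.+1) n.+1) : reorder s^-1 x = x.
    by apply/ffunP => i; rewrite ffunE s1 invg1 perm1.
  rewrite !s1E.
  have replE c (x : word l n.+1) :
      replace_at q (level c (tnth m q)) (lift_word t x) =
      lift_word t (replace_at q c x).
    by apply/ffunP => i; rewrite !ffunE; case: eqP => // ->.
  (* Only letters of one level occur at [q] in the codeword, so the sum over [l * t.+1] letters
     becomes one over [l]. *)
  rewrite (@sum_level _ _ _ (tnth m q)) => [|c cq]; last first.
    rewrite wentry_pure; suff -> : amplitude psi (replace_at q c (lift_word t a)) = 0.
      by rewrite mul0r.
    apply/eqP; apply: contraNT cq => /amplitude_MH_levels /forallP /(_ q).
    by rewrite ffunE eqxx.
  by apply: eq_bigr => c _; rewrite !replE !wentry_pure !amplitude_MH_lift.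
pose S := subroutine1 m r (indel m r) :|: subroutine2 m r (indel m r).
rewrite -/S in pS cardS *.
(* Deleting [S] from the received state will amount to deleting [s @: S], of the same size, from the
   codeword. *)
have eJ : #|~: (s @: S)| = #|~: S|.
  by rewrite [LHS]cardsCs [RHS]cardsCs !setCK card_imset //; exact: perm_inj.
rewrite -(deletion_decoderE eJ); last first.
  by rewrite card_imset; [exact: leq_trans ht | exact: perm_inj].
congr Del.
pose f : 'M[C]_(l * t.+1) := \matrix_(c, c') ((outcome_prob rho r)^-1 *
  (((c %% t.+1 == tnth r p) && (c' %% t.+1 == tnth r p))%N%:R * pi c c')).
have sigmaE : deletion (erefl #|~: S|) (post_state rho r) =
    \tr f *: deletion eJ (pure psi).
  apply: (deletion_relocated _ _ pS) => [i j iS jS|x y].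
    by apply: lift_perm1_lt; [apply: contraNneq iS => -> | apply: contraNneq jS => ->].
  rewrite lift_perm_id post_stateE rhoE mxE -!mulrA; congr (_ * _).
  rewrite mulrCA [RHS]mulrCA; congr (_ * _); rewrite !mulr_sumr.
  apply: eq_bigr => c _; rewrite !wentry_pure.
  have lev0 x' : amplitude psi (replace_at q c (reorder s^-1 x')) != 0 ->
      has_levels r x' = (x' p %% t.+1 == tnth r p)%N.
    move=> a0; apply/forallP/idP => [//|xp i].
    case: (unliftP p i) => [k ->|->//].
    by rewrite (levels c) // ?(eq_sym _ p) ?neq_lift // lift_perm_lift perm1 rm.
  case: (eqVneq (amplitude psi (replace_at q c (reorder s^-1 x))) 0) => [->|/lev0 ->].
    by rewrite !mul0r !mulr0.
  case: (eqVneq (amplitude psi (replace_at q c (reorder s^-1 y))) 0) => [->|/lev0 ->//].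
  by rewrite rmorph0 !mulr0.
rewrite sigmaE; suff -> : \tr f = 1 by rewrite scale1r.
(* The trace of [f] comes from comparing traces in [sigmaE]: both states have trace 1. *)
have := trace_deletion (erefl #|~: S|) (post_state rho r).
rewrite sigmaE (trace_post_state p0) mxtraceZ trace_deletion.
by rewrite (trace_pure_MH t iV umu) mulr1.
Qed.
End Decoder.

Theorem theorem2 (R : realType) (t n l u : nat)
  (ht : (2 <= t)%N) (hn : (1 <= n)%N) (hl : (1 <= l)%N) (hu : (1 <= u)%N)
  (V : 'M[R[i]]_(qdim l n, qdim l u))
  (hV : erasure_correcting t V)
  (Del : forall m : nat, 'M[R[i]]_(qdim (l * t.+1) m) -> 'M[R[i]]_(qdim l u))
  (hDel : deletion_decoder V Del)
  (Uni : 'M[R[i]]_(qdim l n) -> 'M[R[i]]_(qdim l u))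
  (hUni : unitary_decoder V Uni)
  (mu : 'cV[R[i]]_(qdim l u)) (hmu : unit_vector mu)
  (rho : 'M[R[i]]_(qdim (l * t.+1) n))
  (hrho : insdel1 (pure (MH_codeword t V mu)) rho)
  (r : n.-tuple 'I_t.+1) (hr : outcome_prob rho r != 0) :
  decode Del Uni rho r = pure mu.
Proof.
case: n hn V hV Del hDel Uni hUni mu hmu rho hrho r hr => // n _ V [iV _] Del hDel.
move=> Uni hUni mu umu rho [j1 [j2 [pi [[_ tr1] rhoE]]]] r.
(* Equal positions cancel. Otherwise [p] is the position of the inserted qudit after the deletion,
   and [q] below is that of the deleted qudit in the codeword. *)
case: (unliftP j1 j2) rhoE => [p j2E|->] rhoE; last first.
  by rewrite rhoE insdel_same //; apply: decode_codeword.
case: (unliftP j2 j1) => [q j1E|/esym j12]; last first.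
  by have := neq_lift j1 p; rewrite -j2E j12 eqxx.
apply: (@decode_relocated _ _ _ _ _ _ V iV Del hDel Uni hUni mu umu p q pi) => // x y.
by rewrite rhoE (insdel_diff _ _ _ _ j2E j1E).
Qed.
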